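(* Let $G$ be a connected $r$-regular graph with $n$ vertices and $m$ edges. If $r+1=2^t$ for some integer $t\ge 2$, then the Q-graph $\mathcal Q(G)$ does not have Laplacian perfect pair state transfer between any two distinct pair states.
   Context: The Q-graph $\mathcal Q(G)$ is obtained from $G$ by inserting a new vertex into each edge of $G$ and joining by an edge each pair of new vertices lying on adjacent edges of $G$. For a simple graph $H$ with Laplacian $L_H=D_H-A_H$ and characteristic vectors $\mathbf e_u$ of vertices, a pair state is $\mathbf e_a-\mathbf e_b$ for distinct vertices $a,b$. $H$ has Laplacian perfect pair state transfer between distinct pair states $\mathbf e_a-\mathbf e_b$ and $\mathbf e_c-\mathbf e_d$ if there exist $\tau\in\mathbb R$ and $\chi\in\mathbb C$ with $|\chi|=1$ such that $\exp(-\mathrm i\tau L_H)(\mathbf e_a-\mathbf e_b)=\chi(\mathbf e_c-\mathbf e_d)$.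
   Formalization: Distinct pair states are taken to mean {a,b} ≠ {c,d} as unordered pairs, since e_a − e_b and e_b − e_a = −(e_a − e_b) are always related by trivial transfer at τ = 0 with χ = −1. *)

(* Defs.v *)
From HB Require Import structures.
From mathcomp Require Import all_boot all_order all_algebra.
From mathcomp Require Import all_classical all_reals all_analysis.
From mathcomp Require Import complex.
Set Implicit Arguments. Unset Strict Implicit. Unset Printing Implicit Defensive.
Import Order.TTheory GRing.Theory Num.Theory ComplexField.
Import numFieldNormedType.Exports.
Local Open Scope ring_scope.

Definition simple_graph (T : finType) (adj : rel T) : Prop :=
  symmetric adj /\ irreflexive adj.

Definition connected_graph (T : finType) (adj : rel T) : Prop :=
  forall x y : T, connect adj x y.

Definition regular_graph (T : finType) (adj : rel T) (r : nat) : Prop :=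
  forall x : T, #|[set y | adj x y]| = r.

Definition is_edge (T : finType) (adj : rel T) (e : {set T}) : bool :=
  [exists x, exists y, adj x y && (e == [set x; y])].

Definition edge_type (T : finType) (adj : rel T) : finType :=
  {e : {set T} | is_edge adj e}.

Definition Qgraph_vertex (T : finType) (adj : rel T) : finType :=
  (T + edge_type adj)%type.

Definition Qgraph_adj (T : finType) (adj : rel T) : rel (Qgraph_vertex adj) :=
  fun u w =>
    match u, w with
    | inl x, inl y => false
    | inl x, inr e => x \in val e
    | inr e, inl x => x \in val e
    | inr e, inr f => (e != f) && ~~ [disjoint val e & val f]
    end.

Notation Cx R := (complex R).

Definition laplacian (R : realType) (T : finType) (adj : rel T) : 'M[Cx R]_#|T| :=
  \matrix_(i, j)
    (if i == j then (#|[set y | adj (enum_val i) y]|)%:R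
     else if adj (enum_val i) (enum_val j) then -1 else 0).

(** Matrix exponential, as the (entrywise) limit of the partial sums
    sum_{k<N} A^k / k!; the limit is taken in C viewed as a normed space
    over itself (the regular structure (Cx R)^o, norm = complex modulus). *)
Definition mexp (R : realType) (n : nat) (A : 'M[Cx R]_n) : 'M[Cx R]_n :=
  \matrix_(i, j)
    limn ((fun N : nat => \sum_(k < N) ((A ^+ k) i j / (k`!)%:R))
            : nat -> (Cx R)^o).

Definition charvec (R : realType) (T : finType) (u : T) : 'cV[Cx R]_#|T| :=
  \col_i (if enum_val i == u then 1 else 0).

Definition pair_state (R : realType) (T : finType) (a b : T) : 'cV[Cx R]_#|T| :=
  charvec R a - charvec R b.

Definition laplacian_PPST (R : realType) (T : finType) (adj : rel T)
    (a b c d : T) : Prop :=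
  [/\ a != b, c != d, [set a; b] != [set c; d] &
   exists (tau : R) (chi : Cx R), `|chi| = 1 /\
     mexp (- ('i%C * (tau%:C)%C) *: laplacian R adj) *m pair_state R a b
       = chi *: pair_state R c d].

(* Main.v *)
Require Import Defs.
From HB Require Import structures.
From mathcomp Require Import all_boot all_order all_algebra.
From mathcomp Require Import all_classical all_reals all_analysis.
From mathcomp Require Import complex ring lra zify.
Import Order.TTheory GRing.Theory Num.Theory ComplexField.
Import numFieldNormedType.Exports.
Local Open Scope ring_scope.
Set Implicit Arguments.
Unset Strict Implicit.
Unset Printing Implicit Defensive.

(** Let A be the adjacency matrix of G and B its vertex-edge incidence matrix.
    Shifting the Laplacian of the Q-graph by r + 1 = 2^t, every eigenvector x of A
    with eigenvalue k lifts to eigenvectors ((mu - 2^t) x, mu B^T x) for the two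
    roots of mu^2 + k mu = 2^t, and every h with B h = 0 lifts to (0, h) with
    mu = 2^t.  If exp(-i tau L) sends p to chi q, then pairing with a real
    eigenvector w gives <w,q> = +-<w,p>, and the relative sign of two eigenvectors
    is the parity of the integer (tau/pi)(mu1 - mu2).  The two roots above one k
    have product -2^t, so these parities are rigid 2-adically: an odd ratio of the
    two roots forces k = 0, because k^2 is an algebraic integer.  Hence, for pairs
    of vertices and for pairs of new vertices, all k <> -r in the support carry the
    same sign, and what is left (k = -r, respectively the kernel of B) is excluded
    by counting supports and by an alternating 4-cycle.  For a vertex and a new
    vertex, mu = 1 and mu = 2^t both lie in the support, so all mu there are integers
    dividing 2^t, hence even or +-1, and the sum of the two edge components would be
    constant on all edges. *)

(** * Complex exponentials and transfer along real eigenvectors *)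

Lemma hermsymmx_real_complex (R : realType) (n : nat) (A : 'M[R]_n) :
  A^T = A -> map_mx (real_complex R) A \is hermsymmx.
Proof.
move=> symA; apply/is_hermitianmxP; rewrite expr0 scale1r.
apply/matrixP=> i j; rewrite !mxE -{1}symA mxE.
by apply/esym/CrealP/complex_realP; exists (A j i).
Qed.

Lemma cvg_real_complex (R : realType) (u : nat -> R) (l : R) :
  (u @ \oo --> l)%classic ->
  (((fun n => (u n)%:C%C) : nat -> (Cx R)^o) @ \oo --> (l%:C%C : (Cx R)^o))%classic.
Proof.
move=> ul; apply/cvgrPdist_lt => /= eps eps_gt0.
have /complex_realP[e eE] : eps \is Num.real by apply: gtr0_real.
rewrite eE ltcR in eps_gt0.
move/cvgrPdist_lt: ul => /(_ _ eps_gt0); apply: filterS => n.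
by rewrite -raddfB /= normc_def /= expr0n addr0 sqrtr_sqr eE ltcR.
Qed.

Definition cis (R : realType) (x : R) : Cx R := (cos x +i* sin x)%C.

(** Since i^2 = -1, the k-th power of i is a sign times 1 or i according to the parity of k, so the
    exponential series splits term by term into the cosine and sine series. *)
Lemma cvg_exp_cis (R : realType) (x : R) :
  (((fun N => \sum_(k < N) (('i%C * (x%:C)%C) ^+ k / (k`!)%:R))
      : nat -> (Cx R)^o) @ \oo --> (cis x : (Cx R)^o))%classic.
Proof.
have termE k : ('i%C * (x%:C)%C) ^+ k / (k`!)%:R
    = (cos_coeff x k)%:C%C + 'i%C * (sin_coeff x k)%:C%C :> Cx R.
  have -> : (k`!)%:R = (k`!%:R : R)%:C%C :> Cx R by rewrite rmorph_nat.
  rewrite -fmorphV /= exprMn -rmorphXn /= -mulrA -rmorphM /=.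
  have iE : ('i%C : Cx R) ^+ k = (-1) ^+ k./2 * 'i%C ^+ odd k.
    by rewrite -{1}(odd_double_half k) addnC exprD -mul2n exprM sqr_i.
  rewrite iE /cos_coeff /sin_coeff /=.
  (* [sin_coeff] carries the sign exponent [k.-1./2], which agrees with [k./2] exactly where that
     coefficient matters, at odd [k]. *)
  have oE : k.-1./2 = k./2 :> nat \/ ~~ odd k.
    by case: (k) => [|n]; [left | case: (boolP (odd n)) => hn; 
      [right; rewrite /= negbK | left; rewrite /= uphalf_half (negbTE hn)]].
  have sgnE n : ((-1) ^+ n : Cx R) = ((-1) ^+ n : R)%:C%C.
    by rewrite rmorphXn rmorphN1.
  case: (boolP (odd k)) oE => hk /=.
    case=> // ->; rewrite expr1 !(mul0r, mul1r) add0r sgnE.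
    by rewrite mulrAC -[_ * 'i%C]mulrC -mulrA -rmorphM /= mulrA.
  move=> _; rewrite expr0 mulr1 !(mul0r, mul1r) mulr0 addr0 sgnE.
  by rewrite -rmorphM /= mulrA.
have -> : (fun N => \sum_(k < N) (('i%C * (x%:C)%C) ^+ k / (k`!)%:R)) =
  (fun N => (series (cos_coeff x) N)%:C%C + 'i%C * (series (sin_coeff x) N)%:C%C :> Cx R).
  apply/funext => N; rewrite /series /= !big_mkord !rmorph_sum mulr_sumr -big_split.
  by apply: eq_bigr => k _; rewrite termE.
rewrite (_ : cis x = (cos x)%:C%C + 'i%C * (sin x)%:C%C); last first.
  by rewrite /cis; simpc.
apply: (@cvgD _ (Cx R)^o).
  apply: cvg_real_complex; rewrite cos.unlock; exact: is_cvg_series_cos_coeff.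
apply: (@cvgMl_tmp (Cx R)).
by apply: cvg_real_complex; rewrite sin.unlock; exact: is_cvg_series_sin_coeff.
Qed.

(** A real symmetric matrix is Hermitian over the complex numbers, so it is unitarily diagonalisable
    with real spectrum, and taking [Re] of the diagonal loses nothing. *)
Lemma real_spectral (R : realType) (n : nat) (A : 'M[R]_n) : A^T = A ->
  exists (P : 'M[Cx R]_n) (d : 'I_n -> R), P \in unitmx /\
    map_mx (real_complex R) A
      = invmx P *m diag_mx (\row_i (d i)%:C%C) *m P.
Proof.
move=> /hermsymmx_real_complex hA.
have /hermitian_normalmx/orthomx_spectralP AE := hA.
exists (spectralmx (map_mx (real_complex R) A)).
exists (fun i => complex.Re (spectral_diag (map_mx (real_complex R) A) 0 i)).
split; first exact: spectral_unit.
rewrite {1}AE; congr (_ *m diag_mx _ *m _); apply/rowP => i; rewrite mxE RRe_real //.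
by have /mxOverP := hermitian_spectral_diag_real hA; apply.
Qed.

(** The eigenvectors of a symmetric matrix span the space. The spectral basis is complex, so the
    real and imaginary parts of its rows serve as the real eigenvectors. *)
Lemma symmetric_eigen_separate (R : realType) (T : finType) (m : T -> T -> R)
    (y : T -> R) : (forall u v, m u v = m v u) ->
  (forall (k : R) (x : T -> R), (forall u, \sum_v m u v * x v = k * x u) ->
     \sum_u x u * y u = 0) ->
  forall u, y u = 0.
Proof.
move=> symm orthy.
pose A : 'M[R]_#|T| := \matrix_(i, j) m (enum_val i) (enum_val j).
have symA : A^T = A by apply/matrixP => i j; rewrite !mxE symm.
have [P [d [uP AE]]] := real_spectral symA.
pose Y : 'cV[Cx R]_#|T| := \col_i (y (enum_val i))%:C%C.
have sumT (F : T -> R) : \sum_v F v = \sum_(i < #|T|) F (enum_val i).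
  by rewrite -(big_enum_val F); apply: eq_bigl.
have PA : P *m map_mx (real_complex R) A = diag_mx (\row_i (d i)%:C%C) *m P.
  by rewrite AE !mulmxA mulmxV // mul1mx.
have PAij l i : \sum_j P l j * (m (enum_val j) (enum_val i))%:C%C
    = (d l)%:C%C * P l i.
  have /matrixP/(_ l i) := PA; rewrite mul_diag_mx !mxE => <-.
  by apply: eq_bigr => j _; rewrite !mxE.
(* Meant for [f] the real or the imaginary part: both commute with the real eigenvalue [d l], so
   each sends row [l] of [P] to a real eigenvector. *)
have part (f : {additive Cx R -> R}) l :
    (forall (a : R) z, f (a%:C%C * z) = a * f z) -> \sum_i f (P l i) * y (enum_val i) = 0.
  move=> fZ; have := orthy (d l) (fun u => f (P l (enum_rank u))) _.
  rewrite sumT; under eq_bigr do rewrite enum_valK; apply => u.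
  rewrite sumT -fZ -PAij raddf_sum; apply: eq_bigr => j _.
  by rewrite enum_valK enum_rankK [P l j * _]mulrC fZ symm.
have PY : P *m Y = 0.
  apply/colP => l; rewrite !mxE; apply/eqP; rewrite eq_complex.
  rewrite !raddf_sum /=; apply/andP; split; apply/eqP.
    rewrite -[RHS](part (@complex.Re R : {additive Cx R -> R}) l) //.
      by apply: eq_bigr => i _; rewrite !mxE /=; case: (P l i) => a b /=; rewrite mulr0 subr0.
    by move=> a [b c] /=; rewrite mul0r subr0.
  rewrite -[RHS](part (@complex.Im R : {additive Cx R -> R}) l) //.
    by apply: eq_bigr => i _; rewrite !mxE /=; case: (P l i) => a b /=; rewrite mulr0 add0r.
  by move=> a [b c] /=; rewrite mul0r addr0.
have Y0 : Y = 0 by rewrite -[Y](mulKmx uP) PY mulmx0.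
move=> u; have /colP/(_ (enum_rank u)) := Y0; rewrite !mxE enum_rankK.
by case.
Qed.

(** [limn] has a default value on divergent sequences, so [mexp] is usable only once convergence is
    known; diagonalisation reduces it to the scalar series of [cis]. *)
Lemma cvg_mexp_entry (R : realType) (n : nat) (A : 'M[R]_n) (tau : R)
    (i j : 'I_n) (M := - ('i%C * (tau%:C)%C) *: map_mx (real_complex R) A) :
  A^T = A ->
  (((fun N : nat => \sum_(k < N) ((M ^+ k) i j / (k`!)%:R)) : nat -> (Cx R)^o)
     @ \oo --> (mexp M i j : (Cx R)^o))%classic.
Proof.
move=> /real_spectral[P [d [uP AE]]].
suff [l cl] : exists l : (Cx R)^o, (((fun N : nat => \sum_(k < N) ((M ^+ k) i j / (k`!)%:R)) : nat -> (Cx R)^o)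
     @ \oo --> l)%classic.
  by rewrite mxE (cvg_lim _ cl) //; exact: norm_hausdorff.
pose c l := - tau * d l.
have ME k : M ^+ k = invmx P *m diag_mx (\row_l ('i%C * (c l)%:C%C) ^+ k) *m P.
  have M1 : M = invmx P *m diag_mx (\row_l ('i%C * (c l)%:C%C)) *m P.
    rewrite /M AE scalemxAl scalemxAr -linearZ /=; congr (_ *m diag_mx _ *m _).
    by apply/rowP => l; rewrite !mxE /c rmorphM rmorphN /=; ring.
  elim: k => [|k IH].
    rewrite expr0 (_ : (\row_l _) = const_mx 1); last first.
      by apply/rowP => l; rewrite !mxE.
    by rewrite diag_const_mx mulmx1 mulVmx.
  rewrite exprSr IH M1 -[LHS]/(_ *m _) !mulmxA; congr (_ *m _).
  rewrite mulmxK // -mulmxA; congr (_ *m _); rewrite mulmx_diag; congr diag_mx.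
  by apply/rowP => l; rewrite !mxE exprSr.
have -> : (fun N : nat => \sum_(k < N) ((M ^+ k) i j / (k`!)%:R)) =
   (fun N => \sum_(l < n) (invmx P i l * P l j) *
       \sum_(k < N) ('i%C * (c l)%:C%C) ^+ k / (k`!)%:R).
  apply/funext => N; under [RHS]eq_bigr do rewrite mulr_sumr.
  rewrite exchange_big; apply: eq_bigr => k _; rewrite ME mul_mx_diag mxE mulr_suml.
  by apply: eq_bigr => l _; rewrite !mxE; ring.
exists (\sum_(l < n) (invmx P i l * P l j) * cis (c l)).
apply: (@cvg_big (Cx R)^o) => /=; first exact: add_continuous.
by move=> l _; apply: (@cvgMl_tmp (Cx R)); exact: cvg_exp_cis.
Qed.

(** On an eigenvector each partial sum of the matrix series acts as the same partial sum of the
    scalar series, so both sides are limits of one sequence. *)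
Lemma mul_mexp_eigen (R : realType) (n : nat) (A : 'M[R]_n) (tau lam : R)
    (w : 'rV[R]_n) :
  A^T = A -> w *m A = lam *: w ->
  map_mx (real_complex R) w *m mexp (- ('i%C * (tau%:C)%C) *: map_mx (real_complex R) A)
  = cis (- (tau * lam)) *: map_mx (real_complex R) w.
Proof.
move=> symA wA; set M := _ *: _; set W := map_mx _ w.
have WM : W *m M = ('i%C * (- (tau * lam))%:C%C) *: W.
  rewrite /M -scalemxAr /W -map_mxM wA map_mxZ scalerA; congr (_ *: _).
  by rewrite rmorphN rmorphM /=; ring.
have WMk k : W *m M ^+ k = ('i%C * (- (tau * lam))%:C%C) ^+ k *: W.
  elim: k => [|k IH]; first by rewrite !expr0 scale1r -[RHS]mulmx1.
  by rewrite exprS -[M * _]/(M *m _) mulmxA WM -scalemxAl IH scalerA -exprS.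
apply/rowP => j; rewrite [RHS]mxE.
have c1 : (((fun N => \sum_i W 0 i * \sum_(k < N) ((M ^+ k) i j / (k`!)%:R))
   : nat -> (Cx R)^o) @ \oo --> ((W *m mexp M) 0 j : (Cx R)^o))%classic.
  rewrite [(W *m mexp M) 0 j]mxE; apply: (@cvg_big (Cx R)^o) => /=; first exact: add_continuous.
  by move=> l _; apply: (@cvgMl_tmp (Cx R)); exact: cvg_mexp_entry.
have c2 : (((fun N => (\sum_(k < N) ('i%C * (- (tau * lam))%:C%C) ^+ k / (k`!)%:R) * W 0 j)
   : nat -> (Cx R)^o) @ \oo --> (cis (- (tau * lam)) * W 0 j : (Cx R)^o))%classic.
  by apply: (@cvgMr_tmp (Cx R)); exact: cvg_exp_cis.
apply: (cvg_unique _ c1); first exact: norm_hausdorff.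
set f := (X in (X @ _)%classic); set g := (X in (X @ _)%classic) in c2.
suff -> : f = g by exact: c2.
apply/funext => N; rewrite /f /g.
under [LHS]eq_bigr do rewrite mulr_sumr.
rewrite exchange_big mulr_suml; apply: eq_bigr => k _ /=.
have /rowP/(_ j) := WMk k; rewrite !mxE => wE.
rewrite [RHS]mulrAC -wE mulr_suml; apply: eq_bigr => l _; by rewrite mulrA.
Qed.

(** Reduce modulo 2 pi to [0, 2 pi); cosine is injective on [0, pi], and the other half is reflected
    into it. *)
Lemma cos_eq1_exists (R : realType) (x : R) : cos x = 1 ->
  exists k : int, x = pi * (2 * k)%:~R.
Proof.
move=> cx1.
have pi2_gt0 : 0 < (pi : R) *+ 2 by rewrite pmulrn_lgt0 // pi_gt0.
have cosZ (y : R) (k : int) : cos (y + pi *+ 2 *~ k) = cos y.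
  case: k => n; first by rewrite -pmulrn periodicn //; exact: cosD2pi.
  have := periodicn (@cosD2pi R) n.+1 (y + pi *+ 2 *~ Negz n).
  by rewrite NegzE mulrNz -pmulrn subrK => ->.
pose n := Num.floor (x / (pi *+ 2)); pose y := x - pi *+ 2 *~ n.
have y_ge0 : 0 <= y.
  by rewrite subr_ge0 -mulrzr mulrC -ler_pdivlMr // floor_le.
have y_lt : y < pi *+ 2.
  rewrite ltrBlDr -[X in X + _]mulr1 -mulrzr -mulrDr mulrC -ltr_pdivrMr //.
  by have := floorD1_gt (x / (pi *+ 2)); rewrite intrD addrC.
have cy1 : cos y = 1 by rewrite /y -mulrNz cosZ.
suff y0 : y = 0.
  exists n; move/subr0_eq: y0 => ->; rewrite -mulrzr intrM.
  by ring.
have [ylepi|ygtpi] := leP y pi.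
  apply: cos_inj; rewrite ?cos0 ?in_itv /= ?lexx ?pi_ge0 ?ylepi ?y_ge0 //.
have : cos (pi *+ 2 - y) = 1 by rewrite addrC cosD2pi cosN.
rewrite -cos0 => /cos_inj; rewrite !in_itv /= lexx pi_ge0.
have -> : 0 <= pi *+ 2 - y <= pi by apply/andP; split; lra.
by move=> /(_ isT isT); lra.
Qed.

Definition laplacian_eigen (R : realType) (T : finType) (adj : rel T)
    (w : T -> R) (lam : R) : Prop :=
  forall u, (#|[set v | adj u v]|)%:R * w u - \sum_(v | adj u v) w v = lam * w u.

Section PerfectPairStateTransfer.
Variables (R : realType) (T : finType) (adj : rel T) (a b c d : T).
Hypothesis adjS : simple_graph adj.
Variables (tau : R) (chi : Cx R).
Hypothesis chi1 : `|chi| = 1.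
Hypothesis transfer : mexp (- ('i%C * (tau%:C)%C) *: laplacian R adj)
  *m pair_state R a b = chi *: pair_state R c d.

(** Multiplying the transfer equation on the left by the row of a real eigenvector turns the matrix
    exponential into a scalar phase. *)
Lemma cis_transfer (w : T -> R) (lam : R) : laplacian_eigen adj w lam ->
  cis (- (tau * lam)) * (w a - w b)%:C%C = chi * (w c - w d)%:C%C.
Proof.
case: adjS => sym_adj irr_adj eig_w.
pose L : 'M[R]_#|T| := \matrix_(i, j)
    (if i == j then (#|[set y | adj (enum_val i) y]|)%:R
     else if adj (enum_val i) (enum_val j) then -1 else 0).
have LE : laplacian R adj = map_mx (real_complex R) L.
  apply/matrixP => i j; rewrite !mxE.
  by case: ifP => _; [rewrite rmorph_nat | case: ifP => _; rewrite ?rmorphN1 ?rmorph0].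
have symL : L^T = L.
  apply/matrixP => i j; rewrite !mxE eq_sym sym_adj.
  by case: eqP => [->|].
pose W : 'rV[R]_#|T| := \row_i w (enum_val i).
have sumT (F : T -> R) : \sum_v F v = \sum_(i < #|T|) F (enum_val i).
  by rewrite -(big_enum_val F); apply: eq_bigl.
have WL : W *m L = lam *: W.
  apply/rowP => j; rewrite !mxE -eig_w [X in _ = _ - X]big_mkcond sumT (bigD1 j) //=.
  rewrite [X in _ = _ - X](bigD1 j) //= irr_adj add0r !mxE eqxx mulrC; congr (_ + _).
  rewrite -sumrN; apply: eq_bigr => i nij; rewrite !mxE (negbTE nij) sym_adj.
  by case: ifP; rewrite ?mulr0 ?oppr0 ?mulrN1.
have pairE x y : (map_mx (real_complex R) W *m pair_state R x y) 0 0 = (w x - w y)%:C%C.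
  have charE z : (map_mx (real_complex R) W *m charvec R z) 0 0 = (w z)%:C%C.
    rewrite mxE (bigD1 (enum_rank z)) //= !mxE enum_rankK eqxx mulr1 big1 ?addr0 //.
    move=> i ni; rewrite !mxE; case: eqP => [zE|]; rewrite ?mulr0 //.
    by rewrite -zE enum_valK eqxx in ni.
  by rewrite /pair_state mulmxBr mxE charE mxE charE -rmorphB.
have := congr1 (fun X => (map_mx (real_complex R) W *m X) 0 0) transfer.
rewrite /= mulmxA LE (mul_mexp_eigen tau symL WL) -scalemxAl -scalemxAr.
by rewrite mxE pairE [RHS]mxE pairE.
Qed.

Lemma normr_cis (x : R) : `|cis x| = 1.
Proof. by rewrite normc_def /= cos2Dsin2 sqrtr1. Qed.

Lemma transfer_sqr (w : T -> R) (lam : R) : laplacian_eigen adj w lam ->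
  (w c - w d) ^+ 2 = (w a - w b) ^+ 2.
Proof.
move/cis_transfer/(congr1 (fun z => `|z|)); rewrite !normrM normr_cis chi1 !mul1r.
rewrite !normc_def /= expr0n !addr0 !sqrtr_sqr => -[] e.
by rewrite -[LHS]real_normK ?num_real // -e real_normK ?num_real.
Qed.

(** Comparing the two phase relations eliminates [chi]. All pairings are real, so the remaining
    phase is a sign, and tau (l1 - l2) is an integer multiple of pi whose parity is that sign. *)
Lemma transfer_sign (w1 w2 : T -> R) (l1 l2 : R) :
  laplacian_eigen adj w1 l1 -> laplacian_eigen adj w2 l2 ->
  w1 a - w1 b != 0 -> w2 a - w2 b != 0 ->
  exists (k : int) (e : bool), tau / pi * (l1 - l2) = (2 * k + e%:Z)%:~R /\
    (w1 c - w1 d) * (w2 a - w2 b) = (-1) ^+ e * ((w1 a - w1 b) * (w2 c - w2 d)).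
Proof.
move=> e1 e2; have s1 := transfer_sqr e1; have s2 := transfer_sqr e2.
have := cis_transfer e1; have := cis_transfer e2.
set P1 := w1 a - w1 b in s1 *; set P2 := w2 a - w2 b in s2 *.
set Q1 := w1 c - w1 d in s1 *; set Q2 := w2 c - w2 d in s2 *.
move=> c2 c1 P1n0 P2n0.
have [e E] : exists e : bool, Q1 * P2 = (-1) ^+ e * (P1 * Q2).
  have /eqP := s1; rewrite eqf_sqr => /orP[] /eqP ->;
  have /eqP := s2; rewrite eqf_sqr => /orP[] /eqP ->.
  - by exists false; rewrite mul1r.
  - by exists true; rewrite mulrN mulN1r opprK.
  - by exists true; rewrite mulN1r mulNr.
  - by exists false; rewrite mul1r mulrN mulNr.
have pi_n0 : (pi : R) != 0 by rewrite gt_eqF // pi_gt0.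
have cis_eq : cis (- (tau * l1)) = (-1) ^+ e * cis (- (tau * l2)).
  have Q2n0 : Q2 != 0 by rewrite -sqrf_eq0 s2 sqrf_eq0.
  have nz (z : R) : z != 0 -> z%:C%C != 0 :> Cx R by rewrite (inj_eq (@complexI R)).
  have EC : Q1%:C%C * P2%:C%C = (-1) ^+ e * (P1%:C%C * Q2%:C%C) :> Cx R.
    by rewrite -rmorphM /= E rmorphM rmorphXn rmorphN1 rmorphM.
  apply: (mulIf (nz _ P1n0)); apply: (mulIf (nz _ P2n0)); apply: (mulIf (nz _ Q2n0)).
  rewrite c1 -(mulrA chi) EC.
  transitivity ((-1) ^+ e * P1%:C%C * Q2%:C%C * (chi * Q2%:C%C)); first by ring.
  by rewrite -c2; ring.
have cosE : cos (tau * (l1 - l2)) = (-1) ^+ e.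
  have sgnE : ((-1) ^+ e : Cx R) = ((-1) ^+ e : R)%:C%C.
    by rewrite rmorphXn rmorphN1.
  move: cis_eq; rewrite sgnE /cis !cosN !sinN => -[].
  rewrite !mul0r subr0 addr0 => cE sE.
  rewrite mulrBr cosB cE; have -> : sin (tau * l1) = (-1) ^+ e * sin (tau * l2) by lra.
  by rewrite -!mulrA -mulrDr -!expr2 cos2Dsin2 mulr1.
suff [k kE] : exists k : int, tau * (l1 - l2) = pi * (2 * k + e%:Z)%:~R.
  exists k, e; split => //; by rewrite mulrAC kE mulrAC mulfV // mul1r.
case: e E cis_eq cosE => _ _ cosE /=.
  (* A shift by pi reduces cosine -1 to cosine 1; undoing it turns 2 k into 2 (k - 1) + 1. *)
  have : cos (tau * (l1 - l2) + pi) = 1 by rewrite cosDpi cosE opprK.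
  move=> /cos_eq1_exists[k kE]; exists (k - 1); move/eqP: kE; rewrite -subr_eq0 => /eqP.
  rewrite !(intrD, intrM) intrN /= => kE; lra.
by have [k kE] := cos_eq1_exists cosE; exists k; rewrite addr0.
Qed.

End PerfectPairStateTransfer.

(** * Integrality of rational eigenvalues *)

(** Gauss's lemma: X - x divides p over the rationals, so p factors over the integers with one
    factor proportional to X - x. The leading coefficients multiply to 1, which makes that factor X
    - x up to sign. *)
Lemma root_monic_int (p : {poly int}) (x : rat) :
  p \is monic -> root (map_poly intr p) x -> exists z : int, x = z%:~R.
Proof.
move=> mon_p; rewrite root_factor_theorem => /dvdpP_rat_int[p1 [a a0 pE] [q qE]].
have lc1 : lead_coef p1 * lead_coef q = 1 by rewrite -lead_coefM -qE (monicP mon_p).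
have alc : a * (lead_coef p1)%:~R = 1.
  have := congr1 lead_coef pE; rewrite lead_coefXsubC lead_coefZ.
  by rewrite (lead_coef_map_inj intr_inj) // => <-.
have aE : a = (lead_coef q)%:~R.
  have lcR : (lead_coef p1)%:~R * (lead_coef q)%:~R = 1 :> rat by rewrite -intrM lc1.
  by rewrite -[LHS]mulr1 -[X in a * X]lcR mulrA alc mul1r.
have := congr1 (fun r : {poly rat} => r`_0) pE.
rewrite coefB coefX coefC /= sub0r coefZ coef_map /= aE => xE.
by exists (- (lead_coef q * p1`_0)); rewrite intrN intrM -xE opprK.
Qed.

Lemma ratr_root_monic_int (R : realType) (p : {poly int}) (x : rat) :
  p \is monic -> root (map_poly intr p) (ratr x : R) -> exists z : int, x = z%:~R.
Proof.
move=> mon_p; have -> : map_poly intr p = map_poly ratr (map_poly intr p) :> {poly R}.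
  by rewrite -map_poly_comp; apply: eq_map_poly => z /=; rewrite ratr_int.
by rewrite fmorph_root; exact: root_monic_int.
Qed.

(** The characteristic polynomial of an integer matrix is monic with integer coefficients, so its
    rational roots are integers. *)
Lemma int_eigenvalue_rat_int (R : realType) (T : finType) (m : T -> T -> int)
    (x : T -> R) (k : rat) (u0 : T) : x u0 != 0 ->
  (forall u, \sum_v (m u v)%:~R * x v = ratr k * x u) -> exists z : int, k = z%:~R.
Proof.
move=> xn0 eig.
(* Transposed, because [eigenvalue] speaks of row vectors. *)
pose A : 'M[int]_#|T| := \matrix_(i, j) m (enum_val j) (enum_val i).
apply: (@ratr_root_monic_int R (char_poly A)); first exact: char_poly_monic.
rewrite map_char_poly -eigenvalue_root_char; apply/eigenvalueP.
exists (\row_i x (enum_val i)); last first.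
  apply/eqP => /rowP/(_ (enum_rank u0)); rewrite !mxE enum_rankK.
  exact/eqP.
apply/rowP => j; rewrite !mxE -eig.
rewrite [RHS](_ : _ = \sum_(v in T) (m (enum_val j) v)%:~R * x v); last exact: eq_bigl.
rewrite [RHS]big_enum_val; apply: eq_bigr => i _; by rewrite !mxE mulrC.
Qed.

Lemma rat_quadratic_int (k n : int) (mu : rat) :
  mu ^+ 2 + k%:~R * mu - n%:~R = 0 -> exists z : int, mu = z%:~R.
Proof.
move=> muE; apply: (@root_monic_int ('X^2 + (k%:P * 'X - n%:P))).
  rewrite monicE lead_coefDl ?lead_coefXn // size_polyXn.
  rewrite (leq_ltn_trans (size_polyD _ _)) // gtn_max size_polyN.
  rewrite mul_polyC (leq_ltn_trans (size_scale_leq _ _)) ?size_polyX //=.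
  by rewrite (leq_ltn_trans (size_polyC_leq1 _)).
rewrite rmorphD rmorphXn rmorphB rmorphM /= map_polyX !map_polyC /=.
by apply/eqP; rewrite !hornerE.
Qed.

(** * Parity of integers and odd ratios of roots *)

Definition oddz (z : int) : bool := odd `|z|%N.

(* Dividing out gcd(a,b), the numbers a and b are coprime to (a+b)^2 and to 2^t,
   so a b z = - 2^t (a+b)^2 makes them units. *)
Lemma odd_ratio_opp (t : nat) (a b z : int) : oddz a -> oddz b ->
  a * b < 0 -> a * b * z = - (2 ^+ t * (a + b) ^+ 2) -> a + b = 0.
Proof.
rewrite /oddz => odd_a odd_b ab_lt0 abz.
have [g [a' [b' [gn0 aE bE cop]]]] : exists g a' b' : int,
    [/\ g != 0, a = a' * g, b = b' * g & coprimez a' b'].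
  have gn0 : gcdz a b != 0.
    by rewrite gcdz_eq0; apply/nandP; left; apply: contraTneq odd_a => ->.
  exists (gcdz a b), (a %/ gcdz a b)%Z, (b %/ gcdz a b)%Z.
  split; rewrite ?divzK ?dvdz_gcdl ?dvdz_gcdr //.
  have [u [v uvE]] := Bezoutz a b; apply/coprimezP; exists (u, v) => /=.
  apply: (mulIf gn0); rewrite mulrDl -!mulrA !divzK ?dvdz_gcdl ?dvdz_gcdr //.
  by rewrite uvE mul1r.
have abz' : a' * b' * z = - (2 ^+ t * (a' + b') ^+ 2).
  apply: (mulIf gn0); apply: (mulIf gn0); transitivity (a * b * z).
    by rewrite aE bE; ring.
  by rewrite abz aE bE; ring.
have unit_of (c e : int) : oddz (c * g) -> coprimez c e ->
    c * e * z = - (2 ^+ t * (c + e) ^+ 2) -> `|c|%N = 1%N.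
  rewrite /oddz abszM oddM => /andP[odd_c _] cop_ce ceE.
  have : (c %| 2 ^+ t * (c + e) ^+ 2)%Z.
    have -> : 2 ^+ t * (c + e) ^+ 2 = c * - (e * z) by rewrite mulrN [in RHS]mulrA ceE opprK.
    exact: dvdz_mulr.
  rewrite Gauss_dvdzr; last by rewrite coprimezXr // coprimezE /= coprimen2.
  rewrite -[X in (_ %| X)%Z]mulr1 Gauss_dvdzr ?dvdz1; first by move/eqP.
  by apply: coprimezXr; rewrite /coprimez -[X in gcdz _ (X + _)]mul1r gcdzMDl.
have a1 : `|a'|%N = 1%N by apply: (@unit_of a' b'); rewrite -?aE.
have b1 : `|b'|%N = 1%N.
  by apply: (@unit_of b' a'); rewrite -?bE // 1?coprimez_sym // [b' * a']mulrC [b' + a']addrC.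
have unit_cases (c : int) : `|c|%N = 1%N -> c = 1 \/ c = -1 by lia.
have gg : 0 <= g * g by rewrite -expr2 sqr_ge0.
move: ab_lt0; rewrite aE bE.
by case: (unit_cases _ a1) => ->; case: (unit_cases _ b1) => -> ab_lt0; [nia | ring | ring | nia].
Qed.

Lemma oddz2D1 (j : int) : oddz (2 * j + 1).
Proof. rewrite /oddz; lia. Qed.

Lemma oddzD2 (x y : int) : oddz (x + 2 * y) = oddz x.
Proof. rewrite /oddz; lia. Qed.

Lemma oddzM (x y : int) : oddz (x * y) = oddz x && oddz y.
Proof. by rewrite /oddz abszM oddM. Qed.

(** The ratio gives a b k^2 = - 2^t (a + b)^2, so k^2 is rational. Being an eigenvalue of the
    integer matrix [m] squared, it is an integer, and [odd_ratio_opp] yields a + b = 0. *)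
Lemma odd_ratio_eigenvalue0 (R : realType) (T : finType) (m : T -> T -> int) (x : T -> R)
    (u0 : T) (k mu mu' : R) (t : nat) (a b : int) : x u0 != 0 ->
  (forall u, \sum_v (m u v)%:~R * x v = k * x u) ->
  mu * mu' = - 2 ^+ t -> mu + mu' = - k ->
  oddz a -> oddz b -> mu * b%:~R = mu' * a%:~R -> k = 0.
Proof.
move=> xn0 eig prod sum odd_a odd_b ratio.
have an0 : a%:~R != 0 :> R by rewrite intr_eq0; apply: contraTneq odd_a => ->.
have bn0 : b%:~R != 0 :> R by rewrite intr_eq0; apply: contraTneq odd_b => ->.
have pow_gt0 : 0 < 2 ^+ t :> R by rewrite exprn_gt0.
have mu2 : mu ^+ 2 * b%:~R = - (2 ^+ t * a%:~R) by rewrite -mulNr -prod expr2 -mulrA ratio; ring.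
have abk : a%:~R * b%:~R * k ^+ 2 = - (2 ^+ t * (a + b)%:~R ^+ 2).
  have -> : k = - (mu + mu') by rewrite sum opprK.
  have mu'2 : mu' ^+ 2 * a%:~R = - (2 ^+ t * b%:~R) by rewrite -mulNr -prod expr2 -mulrA -ratio; ring.
  transitivity (a%:~R * (mu ^+ 2 * b%:~R) + b%:~R * (mu' ^+ 2 * a%:~R)
     + 2 * (a%:~R * b%:~R) * (mu * mu')); first by ring.
  by rewrite mu2 mu'2 prod intrD; ring.
have k2E : k ^+ 2 = ratr (- (2 ^+ t * (a + b)%:~R ^+ 2) / (a%:~R * b%:~R)).
  rewrite fmorph_div !(rmorphN, rmorphM, rmorphXn) /= !ratr_int -[ratr 2]/(ratr 2%:~R) ratr_int -abk.
  by field; rewrite an0 bn0.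
have [z zE] : exists z : int, - (2 ^+ t * (a + b)%:~R ^+ 2) / (a%:~R * b%:~R) = z%:~R :> rat.
  apply: (@int_eigenvalue_rat_int R T (fun u v => \sum_i m u i * m i v) x _ u0 xn0) => u.
  rewrite -k2E expr2 -mulrA -eig mulr_sumr.
  under eq_bigr do rewrite rmorph_sum mulr_suml.
  rewrite exchange_big; apply: eq_bigr => i _ /=.
  rewrite mulrCA -eig mulr_sumr; apply: eq_bigr => v _.
  by rewrite intrM mulrA.
move: k2E; rewrite zE ratr_int => k2E.
have ab_lt0 : a * b < 0.
  rewrite -(ltr_int R) intrM.
  have /(congr1 (fun X => X * b%:~R)) := mu2; rewrite -mulrA mulNr => e.
  have h1 : 0 < mu ^+ 2 * (b%:~R * b%:~R).
    apply: mulr_gt0; rewrite -?expr2 exprn_even_gt0 //=.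
    by apply: contraTneq pow_gt0 => mu0; move: prod; rewrite mu0 mul0r => /eqP; rewrite eq_sym oppr_eq0 => /eqP ->; rewrite ltxx.
  by move: h1; rewrite e oppr_gt0 -mulrA pmulr_rlt0.
have abz : a * b * z = - (2 ^+ t * (a + b) ^+ 2).
  apply: (@intr_inj R); rewrite intrM intrM -k2E abk rmorphN rmorphM /= !rmorphXn /=.
  by [].
have ab0 := odd_ratio_opp odd_a odd_b ab_lt0 abz.
apply/eqP; rewrite -sqrf_eq0 -(mulrI_eq0 _ (lregP (mulf_neq0 an0 bn0))) abk ab0.
by rewrite expr0n mulr0 oppr0.
Qed.

(** Write m for s mu. Then m1' = m1 - 2 k1, m2' = m2 - 2 k2 and m1 = m2 + L with L odd, so the
    quadratic terms cancel in m1 m1' = m2 m2' and leave D m2 = N with D even and N odd. Scaling by D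
    makes all four numbers congruent to N modulo 2. *)
Lemma opposite_sign_odd_ratio (R : realType) (s mu1 mu1' mu2 mu2' : R) (k1 k2 l : int) :
  mu1 * mu1' = mu2 * mu2' ->
  s * (mu1 - mu1') = (2 * k1)%:~R -> s * (mu2 - mu2') = (2 * k2)%:~R ->
  s * (mu1 - mu2) = (2 * l + 1)%:~R ->
  exists (d : R) (a a' b b' : int), [/\ oddz a, oddz a', oddz b & oddz b'] /\
    [/\ d * mu1 = a%:~R, d * mu1' = a'%:~R, d * mu2 = b%:~R & d * mu2' = b'%:~R].
Proof.
move=> prod e1 e2 e3.
pose L := 2 * l + 1; pose D := 2 * (L - k1 + k2); pose N := L * (2 * k1 - L).
have DN : D%:~R * s * mu2 = N%:~R.
  have mu1'E : s * mu1' = s * mu1 - (2 * k1)%:~R by rewrite -e1; ring.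
  have mu2'E : s * mu2' = s * mu2 - (2 * k2)%:~R by rewrite -e2; ring.
  have mu1E : s * mu1 = s * mu2 + L%:~R by rewrite -e3; ring.
  have : (s * mu1) * (s * mu1') = (s * mu2) * (s * mu2').
    by rewrite mulrACA prod mulrACA.
  rewrite mu1'E mu2'E mu1E /D /N !(intrM, intrD, intrN, intrB) => h.
  by lra.
exists (D%:~R * s), (N + D * L), (N + D * L - 2 * k1 * D), N, (N - 2 * k2 * D).
have oN : oddz N.
  have -> : N = L * (L + 2 * (k1 - L)) by rewrite /N; ring.
  by rewrite oddzM oddzD2 oddz2D1.
split.
  split => //.
  - have -> : N + D * L = N + 2 * ((L - k1 + k2) * L) by rewrite /D; ring.
    by rewrite oddzD2.
  - have -> : N + D * L - 2 * k1 * D = N + 2 * ((L - k1 + k2) * L - k1 * D) by rewrite /D; ring.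
    by rewrite oddzD2.
  - have -> : N - 2 * k2 * D = N + 2 * (- k2 * D) by ring.
    by rewrite oddzD2.
have mu1E : D%:~R * s * mu1 = (N + D * L)%:~R.
  by rewrite intrD intrM -DN -e3; ring.
split => //.
- by rewrite intrB -mu1E 2!intrM mulrAC -intrM -e1; ring.
- by rewrite intrB -DN 2!intrM mulrAC -intrM -e2; ring.
Qed.

(** With s 2^t = n / d in lowest terms and A, B the two odd phases, d s mu = n - A d and d s mu' = n
    - B d. Their product gives 2^t (n - A d) (n - B d) = - n^2, so n is even, d is odd, and both
    factors are odd. *)
Lemma kernel_phase_odd_ratio (R : realType) (s mu mu' : R) (x : rat) (t : nat) (a b : int) :
  (0 < t)%N -> s = ratr x -> mu * mu' = - 2 ^+ t ->
  s * (2 ^+ t - mu) = (2 * a + 1)%:~R -> s * (2 ^+ t - mu') = (2 * b + 1)%:~R ->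
  exists c d : int, [/\ oddz c, oddz d & mu * d%:~R = mu' * c%:~R].
Proof.
move=> t_gt0 sE prod e1 e2.
pose y := x * 2 ^+ t; pose n := numq y; pose d := denq y.
have dn0 : d%:~R != 0 :> R by rewrite intr_eq0 denq_neq0.
have yE : d%:~R * (s * 2 ^+ t) = n%:~R.
  have : d%:~R * y = n%:~R by rewrite -[y in LHS]divq_num_den mulrC divfK // intr_eq0 denq_neq0.
  move/(congr1 (fun z : rat => ratr z : R)).
  by rewrite /y !rmorphM rmorphXn /= !ratr_int -sE -[ratr 2]/(ratr 2%:~R) ratr_int.
pose A := 2 * a + 1; pose B := 2 * b + 1.
have mE : d%:~R * s * mu = (n - A * d)%:~R.
  by rewrite intrB intrM -e1 -yE; ring.
have m'E : d%:~R * s * mu' = (n - B * d)%:~R.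
  by rewrite intrB intrM -e2 -yE; ring.
have key : 2 ^+ t * (n - A * d) * (n - B * d) = - n ^+ 2.
  apply: (@intr_inj R); rewrite 2!intrM -mE -m'E rmorphXn /= rmorphN rmorphXn /= -yE.
  transitivity (2 ^+ t * (d%:~R * s) ^+ 2 * (mu * mu')); first by ring.
  by rewrite prod; ring.
have odd_nd : oddz n != oddz d.
  have := coprime_num_den y; rewrite -/n -/d => cop.
  case: (boolP (oddz n)) => on; case: (boolP (oddz d)) => od //.
    have : oddz (n * n) by rewrite oddzM on.
    have -> : n * n = 0 + 2 * - (2 ^+ t.-1 * (n - A * d) * (n - B * d)).
      by rewrite -[LHS]opprK -expr2 -key -{1}(prednK t_gt0) exprS; ring.
    by rewrite oddzD2.
  have : (2 %| gcdn `|n| `|d|)%N by rewrite dvdn_gcd !dvdn2; apply/andP.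
  by rewrite (eqP cop).
have odd_sub C : oddz C -> oddz (n - C * d).
  move=> oC; have : oddz (C * d) = oddz d by rewrite oddzM oC.
  by move: odd_nd; move: (C * d) => e; rewrite /oddz; lia.
exists (n - A * d), (n - B * d); split; rewrite ?odd_sub ?oddz2D1 //.
by rewrite -mE -m'E; ring.
Qed.

(** * Incidence structure of the Q-graph *)

(** This is the operator B^T for the vertex-edge incidence matrix B; [edge_star] is B and [adj_sum]
    is A. *)
Definition edge_ends (R : realType) (V : finType) (adj : rel V) (f : V -> R)
    (e : edge_type adj) : R := \sum_(u in val e) f u.

Definition edge_star (R : realType) (V : finType) (adj : rel V)
    (g : edge_type adj -> R) (u : V) : R := \sum_(e : edge_type adj | u \in val e) g e.

Definition adj_sum (R : realType) (V : finType) (adj : rel V) (f : V -> R) (u : V) : R :=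
  \sum_(v | adj u v) f v.

Definition Qfun (R : realType) (V : finType) (adj : rel V) (f : V -> R)
    (g : edge_type adj -> R) (w : Qgraph_vertex adj) : R :=
  match w with inl u => f u | inr e => g e end.

Section Incidence.
Variables (R : realType) (V : finType) (adj : rel V) (r : nat).
Hypotheses (adjS : simple_graph adj) (adj_reg : regular_graph adj r).

Local Notation E := (edge_type adj).
Local Notation Bt := (@edge_ends R V adj).
Local Notation B := (@edge_star R V adj).
Local Notation Ad := (@adj_sum R V adj).

Lemma edgeP (e : E) : exists x y : V, [/\ adj x y, x != y & val e = [set x; y]].
Proof.
case: adjS => _ irr; have /existsP[x /existsP[y /andP[xy /eqP eE]]] := valP e.
by exists x, y; split => //; apply: contraTneq xy => ->; rewrite irr.
Qed.

Lemma edge_of_adj (x y : V) : adj x y -> exists e : E, val e = [set x; y].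
Proof.
move=> xy; have ed : is_edge adj [set x; y].
  by apply/existsP; exists x; apply/existsP; exists y; rewrite xy eqxx.
by exists (Sub [set x; y] ed); rewrite SubK.
Qed.

Lemma edge_adj (e : E) (x y : V) : x \in val e -> y \in val e -> x != y ->
  adj x y /\ val e = [set x; y].
Proof.
have [a [b [ab nab ->]]] := edgeP e; case: adjS => sym _.
rewrite !inE => /orP[] /eqP -> /orP[] /eqP ->; rewrite ?eqxx // => _.
by rewrite sym finset.setUC.
Qed.

Lemma card_edge (e : E) : #|val e| = 2%N.
Proof. by have [x [y [_ nxy ->]]] := edgeP e; rewrite cards2 nxy. Qed.

Lemma edge_endsE (f : V -> R) (e : E) (x y : V) : x != y -> val e = [set x; y] ->
  Bt f e = f x + f y.
Proof. by move=> nxy eE; rewrite /edge_ends eE big_setU1 ?inE //= big_set1. Qed.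

Lemma card_edge_star (u : V) : #|[set e : E | u \in val e]| = r.
Proof.
case: adjS => sym irr; rewrite -(adj_reg u).
pose h v : {set V} := [set u; v].
have h_inj : {in [set v | adj u v] &, injective h}.
  move=> v1 v2; rewrite !inE => uv1 uv2 /setP/(_ v1); rewrite !inE eqxx orbT.
  by move=> /esym/orP[] /eqP // v1u; rewrite v1u irr in uv1.
rewrite -(card_in_imset h_inj) -(card_imset _ val_inj).
apply: eq_card => S; apply/imsetP/imsetP => [[e]|[v]]; rewrite inE.
  move=> ue ->; have [x [y [xy nxy eE]]] := edgeP e.
  move: ue; rewrite eE !inE => /orP[] /eqP uE; subst u.
    by exists y; rewrite // inE.
  by exists x; rewrite ?inE 1?sym // /h finset.setUC.
move=> /edge_of_adj[e eE] ->; exists e; rewrite // inE eE !inE eqxx //.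
Qed.

(** After exchanging the sums, u itself is counted once for each of its r edges, and another vertex
    once if it is adjacent to u, since one edge joins them. *)
Lemma edge_star_ends (f : V -> R) (u : V) : B (Bt f) u = r%:R * f u + Ad f u.
Proof.
case: adjS => sym irr.
rewrite /edge_star /edge_ends; under eq_bigr do rewrite big_mkcond.
rewrite exchange_big (bigD1 u) //=; congr (_ + _).
  under eq_bigr => e -> do [].
  by rewrite big_const -(card_edge_star u) cardsE iter_addr_0 mulr_natl.
rewrite /adj_sum [RHS]big_mkcond [RHS](bigD1 u) //= irr add0r.
apply: eq_bigr => v nvu; case: ifPn => [uv|nuv].
  have [e eE] := edge_of_adj uv.
  rewrite (bigD1 e) ?eE ?inE ?eqxx //= orbT big1 ?addr0 // => e' /andP[ue' ne'].
  case: ifP => // ve'; case/negP: ne'; apply/eqP/val_inj; rewrite /= eE.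
  by have [] := edge_adj ue' ve'; rewrite // eq_sym.
apply: big1 => e ue; case: ifP => // ve; case/negP: nuv.
by have [] := edge_adj ue ve; rewrite // eq_sym.
Qed.

Lemma sum_edge_star (x : V -> R) (g : E -> R) :
  \sum_u x u * B g u = \sum_e Bt x e * g e.
Proof.
rewrite /edge_star /edge_ends; under eq_bigr do rewrite mulr_sumr big_mkcond.
rewrite exchange_big; apply: eq_bigr => e _ /=; rewrite mulr_suml [RHS]big_mkcond.
by apply: eq_bigr.
Qed.

Lemma edge_star_const (c : R) (u : V) : B (fun=> c) u = r%:R * c.
Proof.
by rewrite /edge_star big_const -(card_edge_star u) cardsE iter_addr_0 mulr_natl.
Qed.

Lemma edge_ends_const (c : R) (e : E) : Bt (fun=> c) e = 2 * c.
Proof. by rewrite /edge_ends big_const card_edge iter_addr_0 mulr_natl. Qed.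

(** In matrix form B^T B - 2 I is the adjacency matrix of the line graph: an edge meets itself in
    two vertices, and distinct edges share at most one. *)
Lemma edge_ends_star (g : E -> R) (e : E) :
  \sum_(f : E | (e != f) && ~~ [disjoint val e & val f]) g f = Bt (B g) e - 2 * g e.
Proof.
rewrite /edge_star /edge_ends; under [X in _ = X - _]eq_bigr do rewrite big_mkcond.
have sumE (f : E) : \sum_(u in val e) (if u \in val f then g f else 0) = #|val e :&: val f|%:R * g f.
  rewrite -big_mkcondr /= (eq_bigl (mem (val e :&: val f))); last by move=> u; rewrite !inE.
  by rewrite big_const iter_addr_0 mulr_natl.
rewrite [X in _ = X - _]exchange_big; under [X in _ = X - _]eq_bigr do rewrite sumE.
rewrite [X in _ = X - _](bigD1 e) //= finset.setIid card_edge addrAC subrr add0r big_mkcondr /=.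
rewrite [LHS](eq_bigl (fun f => f != e)); last by move=> f; rewrite eq_sym.
apply: eq_bigr => f nfe; rewrite -setI_eq0.
case: ifPn => [|/negPn /eqP ->]; last by rewrite cards0 mul0r.
rewrite -card_gt0 => I_gt0.
have I_lt2 : (#|val e :&: val f| < 2)%N.
  rewrite ltnNge; apply/negP => I_ge2; case/negP: nfe; apply/eqP/val_inj => /=.
  have Ie : val e :&: val f = val e.
    by apply/eqP; rewrite eqEcard finset.subsetIl card_edge.
  have If : val e :&: val f = val f.
    by apply/eqP; rewrite eqEcard finset.subsetIr card_edge.
  by rewrite -Ie If.
have -> : #|val e :&: val f| = 1%N by apply/eqP; rewrite eqn_leq -ltnS I_lt2.
by rewrite mul1r.
Qed.

Lemma Q_adj_sum_vertex (w : Qgraph_vertex adj -> R) (u : V) :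
  \sum_(v | Qgraph_adj (inl u) v) w v = B (fun e => w (inr e)) u.
Proof. by rewrite big_mkcond big_sumType /= big1 // add0r -big_mkcond. Qed.

Lemma Q_adj_sum_edge (w : Qgraph_vertex adj -> R) (e : E) :
  \sum_(v | Qgraph_adj (inr e) v) w v =
  Bt (fun u => w (inl u)) e + (Bt (B (fun e => w (inr e))) e - 2 * w (inr e)).
Proof. by rewrite big_mkcond big_sumType /= -!big_mkcond edge_ends_star. Qed.

(** The coefficient [2 * r%:R + 2] is the degree 2 r of a new vertex plus the diagonal 2 of B^T B.
    Degrees are computed as adjacency sums of the constant 1. *)
Lemma Q_laplacian_eigen (f : V -> R) (g : E -> R) (lam : R) :
  (forall u, r%:R * f u - B g u = lam * f u) ->
  (forall e, (2 * r%:R + 2) * g e - Bt f e - Bt (B g) e = lam * g e) ->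
  laplacian_eigen (@Qgraph_adj V adj) (Qfun f g) lam.
Proof.
move=> eq_f eq_g.
have degE w : #|[set v | Qgraph_adj w v]|%:R = \sum_(v | Qgraph_adj w v) 1 :> R.
  by rewrite cardsE -sumr_const.
case=> [u|e]; rewrite degE.
  by rewrite !Q_adj_sum_vertex edge_star_const mulr1 -eq_f.
rewrite !Q_adj_sum_edge edge_ends_const /= -eq_g.
have -> : Bt (B (fun=> 1)) e = 2 * r%:R.
  rewrite -(edge_ends_const _ e); apply: eq_bigr => u _; by rewrite edge_star_const mulr1.
by ring.
Qed.

(** B B^T acts on x as r + k, so the Laplacian acts on combinations of x and B^T x by a 2 by 2
    matrix; after the shift by r + 1 its characteristic equation is the quadratic assumed for
    [mu]. *)
Lemma Q_eigen_lift (x : V -> R) (k mu : R) :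
  (forall u, Ad x u = k * x u) -> mu ^+ 2 + k * mu = r.+1%:R ->
  laplacian_eigen (@Qgraph_adj V adj)
    (Qfun (fun u => (mu - r.+1%:R) * x u) (fun e => mu * Bt x e)) (mu + r.+1%:R).
Proof.
move=> eig muE.
have BE u : B (fun e => mu * Bt x e) u = mu * (r%:R + k) * x u.
  by rewrite /edge_star -mulr_sumr -/(edge_star _ _) edge_star_ends eig; ring.
have BtZ (c : R) f e : Bt (fun u => c * f u) e = c * Bt f e.
  by rewrite /edge_ends mulr_sumr.
apply: Q_laplacian_eigen => [u|e]; rewrite -!muE.
  rewrite BE; have := muE; rewrite -natr1 => /esym/(canRL (addrK _)) ->; ring.
have -> : Bt (B (fun e0 => mu * Bt x e0)) e = mu * (r%:R + k) * Bt x e.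
  by rewrite -BtZ; apply: eq_bigr => u _; rewrite BE.
by rewrite BtZ; have := muE; rewrite -natr1 => /esym/(canRL (addrK _)) ->; ring.
Qed.

(** The eigenvalue has the form mu + (r + 1) with mu = r + 1, ready for comparison with the lifted
    ones. *)
Lemma Q_eigen_kernel (g : E -> R) : (forall u, B g u = 0) ->
  laplacian_eigen (@Qgraph_adj V adj) (Qfun (fun=> 0) g) (r.+1%:R + r.+1%:R).
Proof.
move=> Bg0; apply: Q_laplacian_eigen => [u|e]; first by rewrite Bg0; ring.
rewrite [Bt (fun=> 0) e]edge_ends_const mulr0 subr0.
by rewrite [Bt _ e]big1 // subr0 -natr1; ring.
Qed.

End Incidence.

(** * Adjacency spectrum of a regular graph and the kernel of the incidence matrix *)

Section RegularGraphSpectrum.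
Variables (R : realType) (V : finType) (adj : rel V) (r : nat).
Hypotheses (adjS : simple_graph adj) (adj_reg : regular_graph adj r).

Local Notation E := (edge_type adj).
Local Notation Bt := (@edge_ends R V adj).
Local Notation B := (@edge_star R V adj).
Local Notation Ad := (@adj_sum R V adj).
Local Notation Aeig x k := (forall u, Ad x u = k * x u).

Lemma adj_sumE (x : V -> R) (u : V) : Ad x u = \sum_v (adj u v)%:Z%:~R * x v.
Proof.
rewrite /adj_sum big_mkcond; apply: eq_bigr => v _.
by case: (adj u v); rewrite ?mul1r ?mul0r.
Qed.

Lemma sum_adj_sum (x y : V -> R) : \sum_u x u * Ad y u = \sum_u Ad x u * y u.
Proof.
case: adjS => sym _.
under eq_bigr do rewrite adj_sumE mulr_sumr.
rewrite exchange_big; apply: eq_bigr => v _ /=; rewrite adj_sumE mulr_suml.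
by apply: eq_bigr => u _; rewrite sym; ring.
Qed.

Lemma adj_eigen_separate (y : V -> R) :
  (forall x k, Aeig x k -> \sum_u x u * y u = 0) -> forall u, y u = 0.
Proof.
move=> orth; apply: (@symmetric_eigen_separate R V (fun u v => (adj u v)%:Z%:~R)).
  by case: adjS => sym _ u v; rewrite sym.
by move=> k x eig; apply: (orth x k) => u; rewrite adj_sumE eig.
Qed.

(** A y - k0 y is orthogonal to every eigenvector: the factor k - k0 kills those at k0, the
    hypothesis all others. *)
Lemma adj_eigen_of_orth (y : V -> R) (k0 : R) :
  (forall x k, Aeig x k -> k != k0 -> \sum_u x u * y u = 0) -> Aeig y k0.
Proof.
move=> orth u; apply/eqP; rewrite -subr_eq0; apply/eqP.
apply: (@adj_eigen_separate (fun u => Ad y u - k0 * y u)) => x k eig.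
have -> : \sum_u x u * (Ad y u - k0 * y u) = (k - k0) * \sum_u x u * y u.
  under eq_bigr do rewrite mulrBr; rewrite sumrB sum_adj_sum mulrBl !mulr_sumr.
  by congr (_ - _); apply: eq_bigr => v _; rewrite ?eig; ring.
have [->|kn0] := eqVneq k k0; first by rewrite subrr mul0r.
by rewrite (orth x k) // mulr0.
Qed.

(** For c = -1 this is the quadratic form of the Laplacian, for c = 1 that of the signless
    Laplacian; each edge is counted in both directions, whence the factor 2. *)
Lemma adj_energy (x : V -> R) (k c : R) : Aeig x k -> c ^+ 2 = 1 ->
  \sum_u \sum_(v | adj u v) (x u + c * x v) ^+ 2
    = 2 * (r%:R + c * k) * \sum_u x u ^+ 2.
Proof.
move=> eig c2.
have deg1 (f : V -> R) : \sum_u Ad f u = r%:R * \sum_u f u.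
  transitivity (\sum_u 1 * Ad f u); first by apply: eq_bigr => u _; rewrite mul1r.
  rewrite (sum_adj_sum (fun=> 1)) mulr_sumr; apply: eq_bigr => u _; congr (_ * _).
  by rewrite /adj_sum sumr_const -(adj_reg u) cardsE.
transitivity (\sum_u (r%:R * x u ^+ 2 + 2 * c * (x u * Ad x u) + Ad (fun v => x v ^+ 2) u)).
  apply: eq_bigr => u _; have <- : \sum_(v | adj u v) x u ^+ 2 = r%:R * x u ^+ 2.
    by rewrite sumr_const -(adj_reg u) cardsE mulr_natl.
  rewrite /adj_sum !mulr_sumr -!big_split; apply: eq_bigr => v _ /=.
  transitivity (x u ^+ 2 + 2 * c * (x u * x v) + c ^+ 2 * x v ^+ 2); first by ring.
  by rewrite c2 mul1r.
rewrite !big_split /= deg1 -!mulr_sumr.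
have -> : \sum_u x u * Ad x u = k * \sum_u x u ^+ 2.
  by rewrite mulr_sumr; apply: eq_bigr => u _; rewrite eig; ring.
by ring.
Qed.

Lemma sum_sqr_eq0 (I : finType) (P : pred I) (F : I -> R) :
  \sum_(i | P i) F i ^+ 2 = 0 -> forall i, P i -> F i = 0.
Proof.
move=> /eqP; rewrite psumr_eq0 => [|i _]; last exact: sqr_ge0.
by move=> /allP h i Pi; apply/eqP; rewrite -sqrf_eq0; move: (h i); rewrite mem_index_enum Pi; apply.
Qed.

(** At k = - c r the energy vanishes, hence so does each of its squares. *)
Lemma adj_eigen_extremal (x : V -> R) (c : R) : c ^+ 2 = 1 -> Aeig x (- c * r%:R) ->
  forall u v, adj u v -> x u = - c * x v.
Proof.
move=> c2 eig u v uv; have := adj_energy eig c2.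
rewrite mulNr mulrN mulrA -expr2 c2 mul1r subrr mulr0 mul0r => /eqP.
rewrite psumr_eq0 => [|w _]; last by apply: sumr_ge0 => w' _; apply: sqr_ge0.
move=> /allP/(_ u); rewrite mem_index_enum => /(_ isT)/eqP/sum_sqr_eq0/(_ v uv) h.
by apply/eqP; rewrite -subr_eq0 mulNr opprK h.
Qed.

Lemma adj_eigen_lower (x : V -> R) (k : R) (u0 : V) : x u0 != 0 -> Aeig x k -> - r%:R <= k.
Proof.
move=> xn0 eig; have := adj_energy eig (expr1n _ 2).
have sum_gt0 : 0 < \sum_u x u ^+ 2.
  rewrite (bigD1 u0) //= ltr_pwDl ?exprn_even_gt0 //.
  by apply: sumr_ge0 => u _; apply: sqr_ge0.
have : 0 <= \sum_u \sum_(v | adj u v) (x u + 1 * x v) ^+ 2.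
  by apply: sumr_ge0 => u _; apply: sumr_ge0 => v _; apply: sqr_ge0.
move=> h eE; move: h; rewrite eE pmulr_lge0 // pmulr_rge0 // mul1r; lra.
Qed.

Lemma adj_eigen_harmonic_const (y : V -> R) : connected_graph adj -> Aeig y r%:R ->
  forall u v, y u = y v.
Proof.
move=> conn eig u v.
have step w w' : adj w w' -> y w = y w'.
  move=> /(@adj_eigen_extremal y (-1)); rewrite sqrrN expr1n opprK !mul1r.
  by move=> /(_ erefl eig).
have /connectP[p pth ->] := conn u v.
by elim: p u pth => //= w p IH u /andP[/step -> /IH].
Qed.

Lemma edge_ends_eigen_min (x : V -> R) : Aeig x (- r%:R) -> forall e : E, Bt x e = 0.
Proof.
move=> eig e; have [u [v [uv nuv eE]]] := edgeP adjS e.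
have := @adj_eigen_extremal x 1 (expr1n _ _) _ u v uv; rewrite mulN1r => /(_ eig).
by rewrite (edge_endsE x nuv eE) => ->; rewrite mulN1r addNr.
Qed.

(** Crossing an edge negates y. For a neighbour v0 of u0, the r neighbours of u0 and the r
    neighbours of v0 carry opposite nonzero values, so the two sets are disjoint parts of the
    support. *)
Lemma eigen_min_support (y : V -> R) (u0 : V) : (0 < r)%N -> Aeig y (- r%:R) -> y u0 != 0 ->
  (2 * r <= #|[set u | y u != 0%R]|)%N.
Proof.
move=> r_gt0 eig y0.
have step u v : adj u v -> y u = - y v.
  by move=> uv; have := @adj_eigen_extremal y 1 (expr1n _ _) _ u v uv; rewrite !mulN1r; apply.
have [v0] : exists v0, v0 \in [set v | adj u0 v].
  by apply/set0Pn; rewrite -card_gt0 adj_reg.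
rewrite inE => uv0; have yv0 : y v0 = - y u0 by rewrite (step _ _ uv0) opprK.
rewrite mul2n -addnn -{1}(adj_reg u0) -(adj_reg v0).
have dis : [disjoint [set v | adj u0 v] & [set v | adj v0 v]].
  rewrite -finset.setI_eq0; apply/eqP/setP => v; rewrite !inE; apply/negP => /andP[h1 h2].
  case/negP: y0; have := step _ _ h1; have := step _ _ h2; rewrite yv0 => e1 e2.
  by apply/eqP; lra.
rewrite -cardsUI (_ : _ :&: _ = finset.set0); last by apply/eqP; rewrite finset.setI_eq0.
rewrite cards0 addn0; apply: subset_leq_card; apply/fintype.subsetP => v; rewrite !inE.
move=> /orP[] /step h.
  by apply: contraNneq y0 => yv; rewrite h yv oppr0.
by apply: contraNneq y0 => yv; rewrite -oppr_eq0 -yv0 h yv oppr0.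
Qed.

(* If every h with B h = 0 vanished at e, then e = Bt z for some z; the signed
   level set of |z| at an end of e has sum 1 or 2 over e and 0 over the other
   edges, although that total is a multiple of r. *)
Lemma exists_kernel_edge (e : E) : (2 < r)%N ->
  exists h : E -> R, (forall u, B h u = 0) /\ h e != 0.
Proof.
move=> r_gt2.
pose M : 'M[R]_(#|V|, #|{: E}|) := \matrix_(i < #|V|, j < #|{: E}|) ((enum_val i : V) \in val (enum_val j : E))%:R.
pose D : 'rV[R]_#|{: E}| := \row_(j < #|{: E}|) ((enum_val j : E) == e)%:R.
have sumE (F : E -> R) : \sum_f F f = \sum_(j < #|{: E}|) F (enum_val j).
  by rewrite -(big_enum_val F); apply: eq_bigl.
have sumV (F : V -> R) : \sum_f F f = \sum_(j < #|V|) F (enum_val j).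
  by rewrite -(big_enum_val F); apply: eq_bigl.
(* If the indicator of [e] lies outside the row space of the incidence matrix, some column of the
   cokernel is a kernel vector not vanishing at [e]. *)
have [sub|nsub] := boolP (D <= M)%MS.
  have [Z ZE] := submxP sub; exfalso.
  pose z u := Z 0 (enum_rank u).
  have Btz f : Bt z f = (f == e)%:R.
    have /rowP/(_ (enum_rank f)) := ZE; rewrite !mxE enum_rankK => ->.
    rewrite /edge_ends big_mkcond sumV; apply: eq_bigr => i _; rewrite mxE enum_rankK /z enum_valK.
    by case: ifP; rewrite ?mulr1 ?mulr0.
  have [x [y [xy nxy eE zx]]] : exists x y, [/\ adj x y, x != y, val e = [set x; y] & z x != 0].
    have [x [y [xy nxy eE]]] := edgeP adjS e; have := Btz e; rewrite (edge_endsE z nxy eE) eqxx.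
    have [zx0|zxn0] := eqVneq (z x) 0; last by exists x, y.
    rewrite zx0 add0r => zy; exists y, x; split; rewrite ?zy ?oner_neq0 // 1?eq_sym //.
      by case: adjS => ->.
    by rewrite finset.setUC.
  pose h u : int := (z u == z x)%:Z - (z u == - z x)%:Z.
  have zxN : (z x == - z x) = false by apply/negbTE; apply: contra zx => /eqP zxE; apply/eqP; lra.
  have := sum_edge_star (fun u => (h u)%:~R) (fun _ : E => 1 : R).
  under eq_bigr do rewrite (edge_star_const adjS adj_reg) mulr1 mulrC.
  rewrite -mulr_sumr -rmorph_sum /= [X in _ = X](bigD1 e) //= [X in _ = _ + X]big1 => [|f nfe]; last first.
    have [p [q [_ npq fE]]] := edgeP adjS f; rewrite (edge_endsE _ npq fE) mulr1.
    have := Btz f; rewrite (negbTE nfe) (edge_endsE z npq fE) => zpq.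
    have zq : z q = - z p by apply/eqP; rewrite -addr_eq0 addrC zpq.
    by rewrite /h zq eqr_opp eqr_oppLR !(intrB); ring.
  rewrite addr0 mulr1 (edge_endsE _ nxy eE) /h eqxx zxN subr0.
  have := Btz e; rewrite (edge_endsE z nxy eE) eqxx => zxy.
  have -> : (z y == - z x) = false by apply/negP => /eqP zyE; move: zxy; rewrite zyE subrr => /eqP; rewrite eq_sym oner_eq0.
  rewrite subr0 -[r%:R]/(r%:Z%:~R) -intrM -intrD => /intr_inj.
  move: (\sum_i _) => S SE.
  have r3 : (3 : int) <= r%:Z by lia.
  have SE' : r%:Z * S = 1 \/ r%:Z * S = 2 by move: SE; case: (_ == _) => ->; [right | left].
  by have [S0|S1] := lerP S 0; nia.
move: nsub; rewrite submxE => /eqP/rowP nz.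
have [l Dl] : exists l, (D *m cokermx M) 0 l != 0.
  apply/existsP; apply: contraT; rewrite negb_exists => /forallP h.
  by case: nz => l; rewrite [RHS]mxE; apply/eqP; rewrite -[_ == _]negbK; apply: h.
exists (fun f => cokermx M (enum_rank f) l); split.
  move=> u; have /matrixP/(_ (enum_rank u) l) := mulmx_coker M; rewrite !mxE => <-.
  rewrite /edge_star big_mkcond sumE; apply: eq_bigr => j _.
  by rewrite !mxE enum_rankK enum_valK; case: ifP; rewrite ?mul1r ?mul0r.
move: Dl; rewrite mxE (bigD1 (enum_rank e)) //= big1 => [|j nj].
  by rewrite mxE enum_rankK eqxx mul1r addr0.
rewrite mxE; case: eqP => [eE|]; rewrite ?mul0r //.
by rewrite -eE enum_valK eqxx in nj.
Qed.

End RegularGraphSpectrum.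

(** * Indicator functions *)

Definition indic (R : realType) (I : finType) (i j : I) : R := (j == i)%:R.

Lemma sum_indic (R : realType) (I : finType) (x : I -> R) (i : I) :
  \sum_j x j * indic R i j = x i.
Proof.
rewrite (bigD1 i) //= /indic eqxx mulr1 big1 ?addr0 // => j /negbTE ->.
by rewrite mulr0.
Qed.

Lemma sum_indicB (R : realType) (I : finType) (x : I -> R) (i j : I) :
  \sum_k x k * (indic R i k - indic R j k) = x i - x j.
Proof. by under eq_bigr do rewrite mulrBr; rewrite sumrB !sum_indic. Qed.

Lemma indic_refl (R : realType) (I : finType) (i : I) : indic R i i = 1.
Proof. by rewrite /indic eqxx. Qed.

Lemma indic_neq (R : realType) (I : finType) (i j : I) : j != i -> indic R i j = 0.
Proof. by rewrite /indic => /negbTE ->. Qed.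

Lemma indic_sym (R : realType) (I : finType) (i j : I) : indic R i j = indic R j i.
Proof. by rewrite /indic eq_sym. Qed.

Lemma indic_ge0 (R : realType) (I : finType) (i j : I) : 0 <= indic R i j.
Proof. exact: ler0n. Qed.

Lemma indic_cases (R : realType) (I : finType) (i j : I) :
  indic R i j = 0 \/ indic R i j = 1 /\ j = i.
Proof. by rewrite /indic; case: eqP; [right | left]. Qed.

Lemma indic_subr_eq1 (R : realType) (I : finType) (i j k : I) :
  indic R i k - indic R j k = 1 -> k = i.
Proof.
have [->|[_ ->//]] := indic_cases R i k.
by move=> h; exfalso; have := indic_ge0 R j k; lra.
Qed.

(** * Excluding transfer between pair states *)

(** What is kept of state transfer: [P] and [Q] stand for the pairings with the two pair states and
    [s] for tau / pi. As [P] and [Q] are arbitrary functionals, either state may be negated. *)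
Definition transfers (R : realType) (T : finType) (adj : rel T) (s : R)
    (P Q : (T -> R) -> R) : Prop :=
  (forall w l, laplacian_eigen adj w l -> Q w ^+ 2 = P w ^+ 2) /\
  (forall w1 w2 l1 l2, laplacian_eigen adj w1 l1 -> laplacian_eigen adj w2 l2 ->
     P w1 != 0 -> P w2 != 0 ->
     exists (k : int) (e : bool), s * (l1 - l2) = (2 * k + e%:Z)%:~R /\
       Q w1 * P w2 = (-1) ^+ e * (P w1 * Q w2)).

Lemma transfers_oppl (R : realType) (T : finType) (adj : rel T) (s : R)
    (P P' Q : (T -> R) -> R) : (forall w, P' w = - P w) ->
  transfers adj s P Q -> transfers adj s P' Q.
Proof.
move=> PE [h1 h2]; split=> [w l /h1|w1 w2 l1 l2 e1 e2]; first by rewrite PE sqrrN.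
rewrite !PE !oppr_eq0 => /(h2 _ _ _ _ e1 e2) h /h[k [e [sE qE]]]; exists k, e.
by rewrite sE mulrN qE mulNr mulrN.
Qed.

Lemma transfers_oppr (R : realType) (T : finType) (adj : rel T) (s : R)
    (P Q Q' : (T -> R) -> R) : (forall w, Q' w = - Q w) ->
  transfers adj s P Q -> transfers adj s P Q'.
Proof.
move=> QE [h1 h2]; split=> [w l /h1|w1 w2 l1 l2 e1 e2]; first by rewrite QE sqrrN.
rewrite !QE => /(h2 _ _ _ _ e1 e2) h /h[k [e [sE qE]]]; exists k, e.
by rewrite sE mulNr qE !mulrN.
Qed.

Section QgraphTransfer.
Variables (R : realType) (V : finType) (adj : rel V) (r t : nat).
Hypotheses (adjS : simple_graph adj) (adj_reg : regular_graph adj r).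
Hypotheses (t_ge2 : (2 <= t)%N) (rE : r.+1 = (2 ^ t)%N).

Local Notation E := (edge_type adj).
Local Notation Bt := (@edge_ends R V adj).
Local Notation B := (@edge_star R V adj).
Local Notation Ad := (@adj_sum R V adj).
Local Notation Aeig x k := (forall u, Ad x u = k * x u).
Local Notation Qadj := (@Qgraph_adj V adj).
Local Notation N := (r.+1%:R : R).
Local Notation lift x mu :=
  (Qfun (fun u => (mu - N) * x u) (fun e : E => mu * Bt x e)).

Lemma degree_succE : N = 2 ^+ t.
Proof. by rewrite rE natrX. Qed.

Lemma degree_gt2 : (2 < r)%N.
Proof.
by rewrite -ltnS rE; have := leq_pexp2l (isT : (0 < 2)%N) t_ge2; apply: leq_trans.
Qed.

Lemma degree_odd : odd r.
Proof.
have : ~~ odd r.+1 by rewrite rE oddX /= orbF -lt0n (leq_trans _ t_ge2).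
by rewrite /= negbK.
Qed.

Lemma lift_roots (k : R) : exists mu mu' : R,
  [/\ 0 < mu, mu' < 0, mu + mu' = - k & mu * mu' = - N].
Proof.
have N_gt0 : 0 < N by rewrite ltr0n.
pose d := Num.sqrt (k ^+ 2 + 4 * N).
have d2 : d ^+ 2 = k ^+ 2 + 4 * N by rewrite sqr_sqrtr //; have := sqr_ge0 k; lra.
have d_gt : `|k| < d.
  by rewrite -sqrtr_sqr ltr_sqrt; have := sqr_ge0 k; lra.
have := ltr_normlP _ _ d_gt => -[kd1 kd2].
exists ((- k + d) / 2), ((- k - d) / 2); by split; lra.
Qed.

Lemma vieta_root_left (k mu mu' : R) : mu + mu' = - k -> mu * mu' = - N -> mu ^+ 2 + k * mu = N.
Proof.
move=> sum prod; have -> : k = - (mu + mu') by rewrite sum opprK.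
by rewrite -[RHS]opprK -prod; ring.
Qed.

Lemma vieta_root_right (k mu mu' : R) : mu + mu' = - k -> mu * mu' = - N -> mu' ^+ 2 + k * mu' = N.
Proof. by move=> sum prod; apply: (@vieta_root_left k mu' mu); rewrite 1?addrC 1?mulrC. Qed.

(** The root mu = N would force k = 1 - N = - r. Thus the vertex factor mu - N of a lift is nonzero
    away from k = - r. *)
Lemma root_neq_degree_succ (k mu : R) : mu ^+ 2 + k * mu = N -> k != - r%:R -> mu != N.
Proof.
move=> muE; apply: contraNneq => mE; rewrite mE in muE.
have Nn0 : N != 0 by rewrite pnatr_eq0.
by apply/eqP/(mulIf Nn0); move: muE; rewrite -natr1; lra.
Qed.

Lemma odd_root_ratio_eigen0 (x : V -> R) (k mu mu' : R) (u0 : V) (a b : int) : x u0 != 0 -> Aeig x k ->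
  mu + mu' = - k -> mu * mu' = - N -> oddz a -> oddz b ->
  mu * b%:~R = mu' * a%:~R -> k = 0.
Proof.
move=> xn0 eig sum prod oa ob rat.
apply: (@odd_ratio_eigenvalue0 R V (fun u v => (adj u v)%:Z) x u0 k mu mu' t a b) => //.
  by move=> u; rewrite -adj_sumE.
by rewrite prod degree_succE.
Qed.

Lemma sum_mul_neq0_exists (x y : V -> R) : \sum_u x u * y u != 0 -> exists u, x u != 0.
Proof.
move=> nz; apply/existsP; apply: contraNT nz; rewrite negb_exists => /forallP x0.
by apply/eqP; apply: big1 => u _; move: (x0 u); rewrite negbK => /eqP ->; rewrite mul0r.
Qed.

(* In the normalisation m = s mu, the pairing of the two roots gives
   m1 (m1 - 2 K1) = m2 (m2 - 2 K2); if the signs differed, m1 - m2 would be odd and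
   then m1, m1' (and m2, m2') would have an odd ratio, forcing k1 = k2 = 0. *)
Lemma transfer_same_sign (s : R) (P Q : (Qgraph_vertex adj -> R) -> R) (y y' : V -> R) (c : R -> R) :
  transfers Qadj s P Q ->
  (forall x mu, P (lift x mu) = c mu * \sum_u x u * y u) ->
  (forall x mu, Q (lift x mu) = c mu * \sum_u x u * y' u) ->
  (forall mu, mu != 0 -> mu != N -> c mu != 0) ->
  exists eps : bool, forall x k, Aeig x k -> k != - r%:R ->
    \sum_u x u * y' u = (-1) ^+ eps * \sum_u x u * y u.
Proof.
move=> [T1 T2] PE QE cn0.
pose phi x := \sum_u x u * y u; pose psi x := \sum_u x u * y' u.
have eqs x k : Aeig x k -> k != - r%:R -> psi x ^+ 2 = phi x ^+ 2.
  move=> eig kn; have [mu [mu' [mu_gt0 mu'_lt0 sum prod]]] := lift_roots k.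
  have muE := vieta_root_left sum prod.
  have := T1 _ _ (Q_eigen_lift adjS adj_reg eig muE); rewrite PE QE !exprMn.
  apply: mulfI; rewrite sqrf_eq0; apply: cn0; first by rewrite gt_eqF.
  exact: root_neq_degree_succ muE kn.
have opp x k : Aeig x k -> k != - r%:R -> psi x != phi x -> psi x = - phi x /\ phi x != 0.
  move=> eig kn ne; have /eqP := eqs _ _ eig kn; rewrite eqf_sqr (negbTE ne) /= => /eqP psiE.
  split=> //; apply: contraNneq ne => phi0; by rewrite psiE phi0 oppr0.
(* Either no eigenvector needs the sign -1, or one such [x1] forces it on every [x2]. *)
have [[x1 [k1 [eig1 kn1 ne1]]]|all_eq] :=
    pselect (exists x1 k1, [/\ Aeig x1 k1, k1 != - r%:R & psi x1 != phi x1]); last first.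
  exists false => x k eig kn; rewrite mul1r; apply/eqP; apply: contrapT => /negP ne.
  by apply: all_eq; exists x, k.
have [psi1 phi1] := opp _ _ eig1 kn1 ne1.
exists true => x2 k2 eig2 kn2; rewrite mulN1r -/(psi x2) -/(phi x2).
apply/eqP; apply: contraT => ne2; exfalso.
have /eqP := eqs _ _ eig2 kn2; rewrite eqf_sqr (negbTE ne2) orbF => /eqP psi2.
have phi2 : phi x2 != 0.
  by apply: contraNneq ne2 => phi0; rewrite psi2 phi0 oppr0.
have [mu1 [mu1' [mu1_gt0 mu1'_lt0 sum1 prod1]]] := lift_roots k1.
have [mu2 [mu2' [mu2_gt0 mu2'_lt0 sum2 prod2]]] := lift_roots k2.
have mu1n0 : mu1 != 0 by rewrite gt_eqF.
have mu2n0 : mu2 != 0 by rewrite gt_eqF.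
have mu1'n0 : mu1' != 0 by rewrite lt_eqF.
have mu2'n0 : mu2' != 0 by rewrite lt_eqF.
have c_n0 k mu : mu ^+ 2 + k * mu = N -> k != - r%:R -> mu != 0 -> c mu != 0.
  by move=> muE kn mun0; apply: cn0 => //; apply: root_neq_degree_succ muE kn.
have sgn (x x' : V -> R) (k k' mu mu' : R) : Aeig x k -> Aeig x' k' ->
    k != - r%:R -> k' != - r%:R -> mu != 0 -> mu' != 0 ->
    mu ^+ 2 + k * mu = N -> mu' ^+ 2 + k' * mu' = N -> phi x != 0 -> phi x' != 0 ->
    exists (l : int) (e : bool), s * (mu - mu') = (2 * l + e%:Z)%:~R /\
      psi x * phi x' = (-1) ^+ e * (phi x * psi x').
  move=> eig eig' kn kn' mun0 mun0' muE muE' ph ph'.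
  have cm := c_n0 _ _ muE kn mun0; have cm' := c_n0 _ _ muE' kn' mun0'.
  have [] := T2 _ _ _ _ (Q_eigen_lift adjS adj_reg eig muE) (Q_eigen_lift adjS adj_reg eig' muE').
  - by rewrite PE mulf_neq0.
  - by rewrite PE mulf_neq0.
  move=> l [e [sE qE]]; exists l, e; split; first by rewrite -sE; congr (_ * _); ring.
  apply: (mulfI cm); apply: (mulfI cm'); move: qE; rewrite !PE !QE -/(phi _) -/(psi _) -/(phi _) -/(psi _) => qE.
  by transitivity (c mu * psi x * (c mu' * phi x')); [ring | rewrite qE; ring].
(* The two lifts of one [x] share their sign, so the scaled difference of the roots is even. *)
have even_diff (x : V -> R) (k mu mu' : R) : Aeig x k -> k != - r%:R -> phi x != 0 -> psi x != 0 ->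
    mu != 0 -> mu' != 0 -> mu + mu' = - k -> mu * mu' = - N ->
    exists l : int, s * (mu - mu') = (2 * l)%:~R.
  move=> eig kn ph ps m0 m0' sum prod.
  have [l [e [sE]]] := sgn _ _ _ _ _ _ eig eig kn kn m0 m0' (vieta_root_left sum prod) (vieta_root_right sum prod) ph ph.
  case: e sE => sE /= qE; last by exists l; rewrite sE addr0.
  exfalso; have : psi x * phi x != 0 by rewrite mulf_neq0.
  by apply/negP; rewrite negbK; apply/eqP; move: qE; rewrite mulN1r [phi x * _]mulrC; lra.
have [l1 e1] : exists l : int, s * (mu1 - mu1') = (2 * l)%:~R.
  by apply: (even_diff x1 k1); rewrite // psi1 oppr_eq0.
have [l2 e2] : exists l : int, s * (mu2 - mu2') = (2 * l)%:~R.
  by apply: (even_diff x2 k2); rewrite // psi2.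
have [l [e [e3 qE]]] : exists (l : int) (e : bool), s * (mu1 - mu2) = (2 * l + e%:Z)%:~R /\
      psi x1 * phi x2 = (-1) ^+ e * (phi x1 * psi x2).
  exact: (sgn x1 x2 k1 k2 mu1 mu2 eig1 eig2 kn1 kn2 mu1n0 mu2n0 (vieta_root_left sum1 prod1) (vieta_root_left sum2 prod2)).
case: e e3 qE => /= e3 qE; last first.
  have : phi x1 * phi x2 != 0 by rewrite mulf_neq0.
  by apply/negP; rewrite negbK; apply/eqP; move: qE; rewrite psi1 psi2 mul1r mulNr; lra.
have [d [a [a' [b [b' [[oa oa' ob ob'] [da da' db db']]]]]]] :
    exists (d : R) (a a' b b' : int), [/\ oddz a, oddz a', oddz b & oddz b'] /\
    [/\ d * mu1 = a%:~R, d * mu1' = a'%:~R, d * mu2 = b%:~R & d * mu2' = b'%:~R].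
  by apply: opposite_sign_odd_ratio e1 e2 e3; rewrite prod1 prod2.
have [u1 xu1] := sum_mul_neq0_exists phi1; have [u2 xu2] := sum_mul_neq0_exists phi2.
have k10 : k1 = 0.
  by apply: (odd_root_ratio_eigen0 xu1 eig1 sum1 prod1 oa oa'); rewrite -da -da'; ring.
have k20 : k2 = 0.
  by apply: (odd_root_ratio_eigen0 xu2 eig2 sum2 prod2 ob ob'); rewrite -db -db'; ring.
(* With both eigenvalues 0, each is the positive square root of N, so the odd integer in [e3] would
   be 0. *)
have mu12 : mu1 = mu2.
  have : mu1 ^+ 2 = mu2 ^+ 2.
    by have := vieta_root_left sum1 prod1; have := vieta_root_left sum2 prod2; rewrite k10 k20; lra.
  by move/eqP; rewrite eqf_sqr => /orP[] /eqP //; lra.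
move: e3; rewrite mu12 subrr mulr0 => /esym/eqP; rewrite intr_eq0 => /eqP l0.
by have := oddz2D1 l; rewrite l0.
Qed.

Lemma sum_edge_ind (x : V -> R) (e : E) : \sum_u x u * (u \in val e)%:R = Bt x e.
Proof.
rewrite /edge_ends [RHS]big_mkcond; apply: eq_bigr => u _.
by case: ifP => _; rewrite ?mulr1 ?mulr0.
Qed.

Lemma edge_star_delta (e : E) (u : V) : B (indic R e) u = (u \in val e)%:R.
Proof.
rewrite /edge_star; have [ue|nue] := boolP (u \in val e).
  rewrite (bigD1 e) //= indic_refl big1 ?addr0 // => f /andP[_ nf]; exact: indic_neq.
by apply: big1 => f uf; apply: indic_neq; apply: contraNneq nue => <-.
Qed.

(** Up to the common sign, the difference of the two states is an eigenvector at - r. It lives on at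
    most four vertices, fewer than the 2 r that a nonzero one needs, so it vanishes. *)
Lemma no_transfer_vertex_vertex (s : R) (a b c d : V) :
  a != b -> c != d -> [set a; b] != [set c; d] ->
  transfers Qadj s (fun w => w (inl a) - w (inl b)) (fun w => w (inl c) - w (inl d)) -> False.
Proof.
move=> nab ncd nset tr.
pose y (u : V) : R := indic R a u - indic R b u.
pose y' (u : V) : R := indic R c u - indic R d u.
have sumy x : \sum_u x u * y u = x a - x b.
  exact: sum_indicB.
have sumy' x : \sum_u x u * y' u = x c - x d.
  exact: sum_indicB.
have [eps epsE] : exists eps : bool, forall x k, Aeig x k -> k != - r%:R ->
    \sum_u x u * y' u = (-1) ^+ eps * \sum_u x u * y u.
  apply: (transfer_same_sign (c := fun mu => mu - N) tr) => [x mu|x mu|mu _ mN].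
  - by rewrite sumy /=; ring.
  - by rewrite sumy' /=; ring.
  - by rewrite subr_eq0.
pose z u := y' u - (-1) ^+ eps * y u.
have eigz : Aeig z (- r%:R).
  apply: (adj_eigen_of_orth adjS) => x k eig kn.
  have -> : \sum_u x u * z u = \sum_u x u * y' u - (-1) ^+ eps * \sum_u x u * y u.
    by rewrite mulr_sumr -sumrB; apply: eq_bigr => u _; rewrite /z; ring.
  by rewrite (epsE x k) // subrr.
have z0 u : z u = 0.
  apply/eqP; apply: contraT => zn0.
  have := eigen_min_support adjS adj_reg (ltnW (ltnW degree_gt2)) eigz zn0.
  have sub : [set u | z u != 0] \subset [set a; b] :|: [set c; d].
    apply/fintype.subsetP => v; rewrite !inE; apply: contraNT; rewrite !negb_or.
    case/andP=> /andP[va vb] /andP[vc vd].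
    by rewrite /z /y /y' !indic_neq // subrr mulr0 subrr.
  have := leq_trans (subset_leq_card sub) (leq_card_setU _ _).
  rewrite !cards2 nab ncd => h1 h2; have := leq_trans h2 h1.
  by have := degree_gt2; lia.
have mem_cd u : y u != 0 -> u \in [set c; d].
  rewrite !inE; apply: contraNT; rewrite negb_or => /andP[uc ud].
  move: (z0 u); rewrite /z /y' (indic_neq _ uc) (indic_neq _ ud) subrr sub0r => /eqP; rewrite oppr_eq0 mulf_eq0.
  by rewrite signr_eq0.
case/negP: nset; rewrite eqEcard !cards2 nab ncd /= andbT.
apply/fintype.subsetP => u; rewrite !inE => /orP[] /eqP ->.
  by have := mem_cd a; rewrite /y indic_refl (indic_neq _ nab) subr0 oner_eq0 !inE; apply.
by have := mem_cd b; rewrite /y indic_refl indic_sym (indic_neq _ nab) sub0r oppr_eq0 oner_eq0 !inE; apply.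
Qed.

(* Comparing the two roots above one eigenvalue k of A gives |1 + mu| = |1 + mu'|,
   that is k = 2. *)
Lemma no_transfer_vertex_edge_pair (a b : V) (e f : E) : a != b ->
  (forall (w : Qgraph_vertex adj -> R) l, laplacian_eigen Qadj w l ->
     (w (inl a) - w (inl b)) ^+ 2 = (w (inr e) - w (inr f)) ^+ 2) -> False.
Proof.
move=> nab sq.
pose y (u : V) : R := indic R a u - indic R b u.
have sumy x : \sum_u x u * y u = x a - x b.
  exact: sum_indicB.
have N_gt0 : 0 < N by rewrite ltr0n.
have eig2 : Aeig y 2.
  apply: (adj_eigen_of_orth adjS) => x k eig; rewrite sumy; apply: contraNeq => ph.
  have [mu [mu' [mu_gt0 mu'_lt0 sum prod]]] := lift_roots k.
  have := sq _ _ (Q_eigen_lift adjS adj_reg eig (vieta_root_left sum prod)) => /= s1.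
  have := sq _ _ (Q_eigen_lift adjS adj_reg eig (vieta_root_right sum prod)) => /= s2.
  move: s1 s2; rewrite -!mulrBr !exprMn; set ps := Bt x e - Bt x f => s1 s2.
  have mun0 : mu != 0 by rewrite gt_eqF.
  have mu'n0 : mu' != 0 by rewrite lt_eqF.
  (* From N = - mu mu' comes mu - N = mu (1 + mu'), and mu^2 cancels. *)
  have h1 : (1 + mu') ^+ 2 * (x a - x b) ^+ 2 = ps ^+ 2.
    apply: (mulfI (_ : mu ^+ 2 != 0)); first by rewrite sqrf_eq0.
    rewrite -s1; have -> : N = - (mu * mu') by rewrite prod opprK.
    by ring.
  have h2 : (1 + mu) ^+ 2 * (x a - x b) ^+ 2 = ps ^+ 2.
    apply: (mulfI (_ : mu' ^+ 2 != 0)); first by rewrite sqrf_eq0.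
    rewrite -s2; have -> : N = - (mu * mu') by rewrite prod opprK.
    by ring.
  have : (1 + mu') ^+ 2 = (1 + mu) ^+ 2.
    by apply: (mulIf (_ : (x a - x b) ^+ 2 != 0)); rewrite ?sqrf_eq0 // h1 h2.
  by move/eqP; rewrite eqf_sqr => /orP[] /eqP h; apply/eqP; lra.
(* At [a] the eigenvector equation equates 2 with a sum over neighbours, where [y] is never
   positive. *)
have := eig2 a; rewrite /adj_sum /y indic_refl (indic_neq _ nab) subr0 mulr1 => h.
have : \sum_(v | adj a v) (indic R a v - indic R b v) <= 0.
  apply: sumr_le0 => v av; rewrite (@indic_neq _ _ a v) ?sub0r ?oppr_le0 ?indic_ge0 //.
  by apply: contraTneq av => ->; case: adjS => _ ->.
by rewrite h; lra.
Qed.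

(** By the condition on ends, g = (e3 - e4) - (e1 - e2) lies in the kernel of B. Pairing g with
    itself gives a nonzero square, so its sign is -1; all kernel vectors have the same eigenvalue,
    hence the same sign. *)
Lemma kernel_sign_opposite (s : R) (e1 e2 e3 e4 : E) :
  e1 != e2 -> (e3 != e1) || (e4 != e2) ->
  transfers Qadj s (fun w => w (inr e1) - w (inr e2)) (fun w => w (inr e3) - w (inr e4)) ->
  (forall u, (u \in val e3)%:R - (u \in val e4)%:R = (u \in val e1)%:R - (u \in val e2)%:R :> R) ->
  exists g : E -> R, [/\ (forall u, B g u = 0), g e1 - g e2 != 0,
    g e3 - g e4 = - (g e1 - g e2) &
    forall h : E -> R, (forall u, B h u = 0) -> h e3 - h e4 = - (h e1 - h e2)].
Proof.
move=> n12 n [T1 T2] ends.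
pose g (f : E) : R := indic R e3 f - indic R e4 f - (indic R e1 f - indic R e2 f).
have Bg u : B g u = 0.
  transitivity (B (indic R e3) u - B (indic R e4) u
     - (B (indic R e1) u - B (indic R e2) u)).
    by rewrite /edge_star -!sumrB.
  by rewrite !edge_star_delta ends subrr.
have gE : g e3 - g e4 - (g e1 - g e2) = \sum_f g f ^+ 2.
  by rewrite -(sum_indicB g e3 e4) -(sum_indicB g e1 e2) -sumrB;
     apply: eq_bigr => f _; rewrite -mulrBr.
have gn0 : \sum_f g f ^+ 2 != 0.
  apply/eqP => /sum_sqr_eq0 g0; move: (g0 e1 isT) (g0 e2 isT); rewrite /g !indic_refl.
  rewrite (indic_neq _ n12) (indic_sym _ e1 e2) (indic_neq _ n12).
  rewrite subr0 sub0r opprK => /subr0_eq/indic_subr_eq1 e13.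
  move=> /eqP; rewrite addr_eq0 => /eqP/(congr1 -%R); rewrite opprB opprK => /indic_subr_eq1 e24.
  by move: n; rewrite e13 e24 !eqxx.
have gsq := T1 _ _ (Q_eigen_kernel adjS adj_reg Bg).
have gopp : g e3 - g e4 = - (g e1 - g e2).
  move/eqP: gsq; rewrite /= eqf_sqr => /orP[] /eqP // h.
  by move: gn0; rewrite -gE h subrr eqxx.
have gP : g e1 - g e2 != 0.
  by apply: contraNneq gn0 => h; rewrite -gE gopp h oppr0 addr0.
exists g; split=> // h Bh.
have [h0|hn0] := eqVneq (h e1 - h e2) 0.
  have /eqP := T1 _ _ (Q_eigen_kernel adjS adj_reg Bh).
  by rewrite /= h0 expr0n sqrf_eq0 => /eqP ->; rewrite oppr0.
have [k [e [sE qE]]] := T2 _ _ _ _ (Q_eigen_kernel adjS adj_reg Bh)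
   (Q_eigen_kernel adjS adj_reg Bg) hn0 gP.
move: qE; rewrite /= gopp; case: e sE => [|_ qE].
  rewrite subrr mulr0 => /esym/eqP; rewrite intr_eq0 => /eqP l0.
  by have := oddz2D1 k; rewrite l0.
by apply: (mulIf gP); rewrite qE; ring.
Qed.

Lemma edge_other_end (e : E) (x : V) : x \in val e ->
  exists y, [/\ adj x y, x != y & val e = [set x; y]].
Proof.
have [a [b [ab nab eE]]] := edgeP adjS e; rewrite eE !inE => /orP[] /eqP ->.
  by exists b.
by exists a; rewrite eq_sym finset.setUC; case: adjS => sym _; rewrite sym.
Qed.

Lemma edge_eq (e f : E) (x y : V) : val e = [set x; y] -> x \in val f -> y \in val f ->
  x != y -> e = f.
Proof.
by move=> eE xf yf nxy; apply: val_inj; have [_ fE] := edge_adj adjS xf yf nxy; rewrite eE fE.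
Qed.

(* e1 and e2 share an end and their other ends x0, z0 have equal neighbourhoods,
   so a third common neighbour closes a 4-cycle through e1 and e2 whose
   alternating sum lies in the kernel but avoids e3 and e4. *)
Lemma aligned_edges_absurd (e1 e2 e3 e4 : E) :
  e1 != e2 -> (e3 != e1) || (e4 != e2) ->
  (forall u, (u \in val e3)%:R - (u \in val e4)%:R = (u \in val e1)%:R - (u \in val e2)%:R :> R) ->
  (forall h : E -> R, (forall u, B h u = 0) -> h e3 - h e4 = - (h e1 - h e2)) ->
  Aeig (fun u => ((u \in val e1)%:Z - (u \in val e2)%:Z)%:~R) 0 -> False.
Proof.
move=> n12 n ends kneg eig0.
have irr := adjS.2; have sym := adjS.1.
have endsb u : ((u \in val e3)%:Z - (u \in val e4)%:Z = (u \in val e1)%:Z - (u \in val e2)%:Z).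
  by apply: (@intr_inj R); rewrite !intrB; exact: ends.
have pos u : u \in val e1 -> u \notin val e2 -> u \in val e3 /\ u \notin val e4.
  move=> h1 h2; move: (endsb u); rewrite h1 (negbTE h2).
  by case: (u \in val e3); case: (u \in val e4).
have neg u : u \notin val e1 -> u \in val e2 -> u \notin val e3 /\ u \in val e4.
  move=> h1 h2; move: (endsb u); rewrite (negbTE h1) h2.
  by case: (u \in val e3); case: (u \in val e4).
have [x0 x0e1 x0e2] : exists2 x0, x0 \in val e1 & x0 \notin val e2.
  have /subsetPn[x0 h1 h2] : ~~ (val e1 \subset val e2).
    apply: contra n12 => sub; apply/eqP/val_inj/eqP.
    by rewrite eqEcard sub !(card_edge adjS).
  by exists x0.
have [z0 z0e2 z0e1] : exists2 z0, z0 \in val e2 & z0 \notin val e1.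
  have /subsetPn[z0 h1 h2] : ~~ (val e2 \subset val e1).
    apply: contra n12 => sub; rewrite eq_sym; apply/eqP/val_inj/eqP.
    by rewrite eqEcard sub !(card_edge adjS).
  by exists z0.
have [x0e3 x0e4] := pos _ x0e1 x0e2; have [z0e3 z0e4] := neg _ z0e1 z0e2.
have [y0 [xy0 nxy0 e1E]] := edge_other_end x0e1.
have [y0' [zy0 nzy0 e2E]] := edge_other_end z0e2.
have [w0 [xw0 nxw0 e3E]] := edge_other_end x0e3.
have [w0' [zw0 nzw0 e4E]] := edge_other_end z0e4.
have y0e1 : y0 \in val e1 by rewrite e1E !inE eqxx orbT.
have y0e2' : y0' \in val e2 by rewrite e2E !inE eqxx orbT.
have w0e3 : w0 \in val e3 by rewrite e3E !inE eqxx orbT.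
have w0e4' : w0' \in val e4 by rewrite e4E !inE eqxx orbT.
have nxz : x0 != z0 by apply: contraNneq z0e1 => <-.
(* Otherwise both ends of [e1] lie on [e3], which gives [e1 = e3] and then [e2 = e4]. *)
have y0e2 : y0 \in val e2.
  apply: contraT => y0e2; have [y0e3 y0e4] := pos _ y0e1 y0e2.
  have e13 : e1 = e3 := edge_eq e1E x0e3 y0e3 nxy0.
  have e24 : e2 = e4.
    apply: val_inj; apply/setP => u; move: (endsb u); rewrite -e13 /=.
    by case: (u \in val e1); case: (u \in val e2); case: (u \in val e4).
  by move: n; rewrite e13 e24 !eqxx.
have y0E : y0' = y0.
  by move: y0e2; rewrite e2E !inE => /orP[/eqP y0z|/eqP //]; rewrite y0z (negbTE z0e1) in y0e1.
have w0e4 : w0 \in val e4.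
  move: (endsb w0); rewrite w0e3 e1E e2E !inE y0E eq_sym (negbTE nxw0) /=.
  have -> : (w0 == z0) = false by apply: contraNF z0e3 => /eqP <-.
  by case: (w0 == y0); case: (w0 \in val e4).
have w0E : w0' = w0.
  by move: w0e4; rewrite e4E !inE => /orP[/eqP w0z|/eqP //]; rewrite -w0z w0e3 in z0e3.
rewrite y0E in zy0 nzy0 e2E; rewrite w0E in zw0 nzw0 e4E.
have nyw : y0 != w0.
  apply: contraTneq n => yw; rewrite negb_or !negbK.
  rewrite -(edge_eq e1E x0e3 _ nxy0) ?eqxx /=; last by rewrite yw.
  by rewrite -(edge_eq e2E z0e4 _ nzy0) ?eqxx // yw.
(* The shared end [y0] cancels in the difference of the two edges, so eigenvalue 0 says precisely
   this. *)
have nbr u : adj u x0 = adj u z0.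
  have := eig0 u; rewrite mul0r /adj_sum -rmorph_sum /= => /eqP; rewrite intr_eq0 => /eqP.
  rewrite sumrB => /subr0_eq; rewrite e1E e2E.
  have count z : z != y0 -> \sum_(v | adj u v) (v \in [set z; y0])%:Z = (adj u z)%:Z + (adj u y0)%:Z.
    move=> nz; rewrite big_mkcond (bigD1 z) //= (bigD1 y0) 1?eq_sym //= !inE !eqxx orbT /=.
    rewrite big1 => [|v /andP[vz vy]]; last by rewrite !inE (negbTE vz) (negbTE vy); case: ifP.
    by rewrite addr0; case: (adj u z); case: (adj u y0).
  by rewrite !count //; case: (adj u x0); case: (adj u z0); case: (adj u y0).
have [u [xu uy uw]] : exists u, [/\ adj x0 u, u != y0 & u != w0].
  have /subsetPn[u h1 h2] : ~~ ([set v | adj x0 v] \subset [set y0; w0]).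
    apply/negP => /subset_leq_card; rewrite adj_reg cards2 nyw.
    by rewrite leqNgt degree_gt2.
  by exists u; move: h1 h2; rewrite !inE negb_or => -> /andP[-> ->].
have zu : adj z0 u by rewrite sym -nbr sym.
have nxu : x0 != u by apply: contraTneq xu => ->; rewrite irr.
have nzu : z0 != u by apply: contraTneq zu => ->; rewrite irr.
have [f1 f1E] := edge_of_adj xu; have [f2 f2E] := edge_of_adj zu.
have xf1 : x0 \in val f1 by rewrite f1E !inE eqxx.
have uf1 : u \in val f1 by rewrite f1E !inE eqxx orbT.
have zf2 : z0 \in val f2 by rewrite f2E !inE eqxx.
have uf2 : u \in val f2 by rewrite f2E !inE eqxx orbT.
have xf2 : x0 \notin val f2 by rewrite f2E !inE negb_or nxz nxu.
have zf1 : z0 \notin val f1 by rewrite f1E !inE negb_or eq_sym nxz nzu.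
have ue1 : u \notin val e1 by rewrite e1E !inE negb_or eq_sym nxu uy.
have ue2 : u \notin val e2 by rewrite e2E !inE negb_or eq_sym nzu uy.
have ue3 : u \notin val e3 by rewrite e3E !inE negb_or eq_sym nxu uw.
have ue4 : u \notin val e4 by rewrite e4E !inE negb_or eq_sym nzu uw.
have ye3 : y0 \notin val e3 by rewrite e3E !inE negb_or eq_sym nxy0 nyw.
have ye4 : y0 \notin val e4 by rewrite e4E !inE negb_or eq_sym nzy0 nyw.
have ne (p q : E) (v : V) : v \in val p -> v \notin val q -> p != q.
  by move=> vp; apply: contraNneq => <-.
have ne' (p q : E) (v : V) : v \notin val p -> v \in val q -> p != q.
  by move=> vp vq; rewrite eq_sym; apply: ne vq vp.
(* Alternating signs around the cycle y0, x0, u, z0: the values at [e1], [e2], [e3], [e4] are 1, -1,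
   0, 0, against [kneg]. *)
pose h (f : E) : R := (indic R e1 f - indic R e2 f) + (indic R f2 f - indic R f1 f).
have Bh v : B h v = 0.
  transitivity ((B (indic R e1) v - B (indic R e2) v) + (B (indic R f2) v - B (indic R f1) v)).
    by rewrite /edge_star -!sumrB -big_split.
  rewrite !edge_star_delta e1E e2E f1E f2E !inE.
  have [->|_] := eqVneq v x0.
    by rewrite (negbTE nxz) (negbTE nxy0) (negbTE nxu) /=; ring.
  have [->|_] := eqVneq v z0; first by rewrite (negbTE nzy0) (negbTE nzu) /=; ring.
  by rewrite /= !subrr addr0.
have := kneg _ Bh; rewrite /h !indic_refl.
rewrite (indic_neq R (ne _ _ _ x0e1 x0e2)) (indic_neq R (ne _ _ _ x0e1 xf2)).
rewrite (indic_neq R (ne' _ _ _ ue1 uf1)) (indic_neq R (ne _ _ _ z0e2 z0e1)).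
rewrite (indic_neq R (ne' _ _ _ ue2 uf2)) (indic_neq R (ne _ _ _ z0e2 zf1)).
rewrite (indic_neq R (ne' _ _ _ ye3 y0e1)) (indic_neq R (ne _ _ _ x0e3 x0e2)).
rewrite (indic_neq R (ne _ _ _ x0e3 xf2)) (indic_neq R (ne' _ _ _ ue3 uf1)).
rewrite (indic_neq R (ne _ _ _ z0e4 z0e1)) (indic_neq R (ne' _ _ _ ye4 y0e2)).
rewrite (indic_neq R (ne' _ _ _ ue4 uf2)) (indic_neq R (ne _ _ _ z0e4 zf1)).
rewrite !subr0 !sub0r !addr0 oppr0 opprK => /esym/eqP.
by rewrite addr0 oppr_eq0 (pnatr_eq0 R 2).
Qed.

(* Each k in the support gives odd integers a, b with a + b = s (2 N + k) and
   a b = s^2 N (r + k). Two different k determine s rationally; if there is only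
   one k, then y is an integer eigenvector and k is an integer. *)
Lemma kernel_phase_rational (s : R) (y : V -> int) (u0 : V) : y u0 = 1 ->
  (forall x k mu, Aeig x k -> mu ^+ 2 + k * mu = N -> \sum_u x u * (y u)%:~R != 0 ->
     exists l : int, s * (N - mu) = (2 * l + 1)%:~R) ->
  exists q : rat, s = ratr q.
Proof.
move=> yu0 phase.
pose phi (x : V -> R) := \sum_u x u * (y u)%:~R.
have vieta x k : Aeig x k -> phi x != 0 -> exists a b : int,
    s * (2 * N + k) = (2 * a)%:~R /\ s ^+ 2 * (N * (r%:R + k)) = (2 * b + 1)%:~R.
  move=> eig ph; have [mu [mu' [_ _ sum prod]]] := lift_roots k.
  have [l lE] := phase _ _ _ eig (vieta_root_left sum prod) ph.
  have [l' l'E] := phase _ _ _ eig (vieta_root_right sum prod) ph.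
  exists (l + l' + 1), (2 * l * l' + l + l').
  have -> : k = - (mu + mu') by rewrite sum opprK.
  split.
    have -> : 2 * (l + l' + 1) = (2 * l + 1) + (2 * l' + 1) by ring.
    by rewrite intrD -lE -l'E; ring.
  have -> : 2 * (2 * l * l' + l + l') + 1 = (2 * l + 1) * (2 * l' + 1) by ring.
  rewrite intrM -lE -l'E.
  have -> : r%:R = N - 1 :> R by rewrite -natr1 addrK.
  transitivity (s ^+ 2 * (N * N - N * (mu + mu') + - N)); first by ring.
  by rewrite -prod; ring.
have [[x1 [k1 [eig1 ph1]]]|none] := pselect (exists x k, Aeig x k /\ phi x != 0); last first.
  exfalso; have y0 : forall u, (y u)%:~R = 0 :> R.
    apply: (@adj_eigen_separate R V adj adjS) => x k eig.
    by apply/eqP; apply: contrapT => /negP ph; apply: none; exists x, k.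
  by have /eqP := y0 u0; rewrite yu0 oner_eq0.
have [a1 [b1 [s1 p1]]] := vieta _ _ eig1 ph1.
have sn0 : s != 0.
  apply/eqP => s0; move: p1; rewrite s0 expr0n mul0r => /esym/eqP; rewrite intr_eq0 => /eqP l0.
  by have := oddz2D1 b1; rewrite l0.
have [[x2 [k2 [eig2 ph2 ne]]]|single] :=
    pselect (exists x k, [/\ Aeig x k, phi x != 0 & k != k1]).
  have [a2 [b2 [s2 p2]]] := vieta _ _ eig2 ph2.
  have dS : s * (k2 - k1) = (2 * a2 - 2 * a1)%:~R by rewrite intrB -s1 -s2; ring.
  have dP : s * N * (2 * a2 - 2 * a1)%:~R = (2 * b2 - 2 * b1)%:~R.
    rewrite -dS; have -> : 2 * b2 - 2 * b1 = (2 * b2 + 1) - (2 * b1 + 1) by ring.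
    by rewrite intrB -p1 -p2; ring.
  have dn0 : (2 * a2 - 2 * a1)%:~R != 0 :> R by rewrite -dS mulf_neq0 // subr_eq0.
  exists ((2 * b2 - 2 * b1)%:~R / ((2 * a2 - 2 * a1)%:~R * r.+1%:R)).
  rewrite fmorph_div rmorphM /= !ratr_int ratr_nat -dP.
  by rewrite -mulrA [N * _]mulrC mulfK // mulf_neq0 // pnatr_eq0.
have eigy : Aeig (fun u => (y u)%:~R) k1.
  apply: (adj_eigen_of_orth adjS) => x k eig kn; apply/eqP; apply: contrapT => /negP ph.
  by apply: single; exists x, k.
(* The eigenvector equation is read at [u0], where [y] is 1. *)
have k1E : k1 = (\sum_(v | adj u0 v) y v)%:~R.
  by have := eigy u0; rewrite yu0 mulr1 => <-; rewrite rmorph_sum.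
(* The bound k1 >= - r keeps the denominator positive. *)
have pos : 2 * N + k1 != 0.
  have := adj_eigen_lower adjS adj_reg (_ : (y u0)%:~R != 0) eigy.
  by rewrite yu0 oner_eq0 => /(_ isT) h; rewrite gt_eqF // -natr1; have : 0 <= r%:R :> R := ler0n _ _; lra.
pose den : rat := 2 * r.+1%:R + (\sum_(v | adj u0 v) y v)%:~R.
have denE : ratr den = 2 * N + k1.
  by rewrite /den rmorphD rmorphM /= [ratr (\sum_(_ | _) _)%:~R]ratr_int k1E !ratr_nat.
exists ((2 * a1)%:~R / den).
by rewrite fmorph_div /= denE ratr_int -s1 mulfK.
Qed.

(** Kernel vectors have sign -1 and lifts have sign 1, so s (N - mu) is odd for every mu in the
    support. Hence s is rational, the roots over one k have an odd ratio, and only k = 0 remains,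
    which the 4-cycle excludes. *)
Lemma no_transfer_edge_edge_aligned (s : R) (e1 e2 e3 e4 : E) :
  e1 != e2 -> (e3 != e1) || (e4 != e2) ->
  transfers Qadj s (fun w => w (inr e1) - w (inr e2)) (fun w => w (inr e3) - w (inr e4)) ->
  (forall u, (u \in val e3)%:R - (u \in val e4)%:R = (u \in val e1)%:R - (u \in val e2)%:R :> R) ->
  False.
Proof.
move=> n12 n tr ends.
have [g [Bg gP gopp kneg]] := kernel_sign_opposite n12 n tr ends.
case: tr => T1 T2.
pose y (u : V) : int := (u \in val e1)%:Z - (u \in val e2)%:Z.
have sumy x : \sum_u x u * (y u)%:~R = Bt x e1 - Bt x e2.
  rewrite -!sum_edge_ind -sumrB; apply: eq_bigr => u _.
  by rewrite /y intrB mulrBr.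
have sumy' x : Bt x e3 - Bt x e4 = Bt x e1 - Bt x e2.
  rewrite -!sum_edge_ind -!sumrB; apply: eq_bigr => u _.
  by rewrite -!mulrBr ends.
have phase x k mu : Aeig x k -> mu ^+ 2 + k * mu = N -> \sum_u x u * (y u)%:~R != 0 ->
     exists l : int, s * (N - mu) = (2 * l + 1)%:~R.
  rewrite sumy => eig muE ph.
  have mun0 : mu != 0.
    apply/eqP => mu0; move/esym/eqP: muE.
    by rewrite mu0 expr0n mulr0 addr0 pnatr_eq0.
  have [] := T2 _ _ _ _ (Q_eigen_kernel adjS adj_reg Bg) (Q_eigen_lift adjS adj_reg eig muE) gP.
    by rewrite /= -mulrBr mulf_neq0.
  move=> l [e [sE]]; rewrite /= -!mulrBr gopp sumy' => qE; exists l.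
  have -> : N - mu = N + N - (mu + N) by ring.
  rewrite sE; case: e qE {sE} => //= qE; exfalso.
  have : (g e1 - g e2) * (mu * (Bt x e1 - Bt x e2)) != 0 by rewrite !mulf_neq0.
  by move/eqP: qE; rewrite mul1r mulNr eqNr => ->.
have [x0 [x0e1 x0e2]] : exists x0, x0 \in val e1 /\ x0 \notin val e2.
  have /subsetPn[x0 h1 h2] : ~~ (val e1 \subset val e2).
    apply: contra n12 => sub; apply/eqP/val_inj/eqP.
    by rewrite eqEcard sub !card_edge.
  by exists x0.
have yx0 : y x0 = 1 by rewrite /y x0e1 (negbTE x0e2).
have [q qE] := kernel_phase_rational yx0 phase.
have eig0 : Aeig (fun u => (y u)%:~R) 0.
  apply: (adj_eigen_of_orth adjS) => x k eig; apply: contraNeq => ph.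
  have [mu [mu' [_ _ sum prod]]] := lift_roots k.
  have [l lE] := phase _ _ _ eig (vieta_root_left sum prod) ph.
  have [l' l'E] := phase _ _ _ eig (vieta_root_right sum prod) ph.
  have [u xu] := sum_mul_neq0_exists ph.
  have [c [d [oc od cd]]] := kernel_phase_odd_ratio (ltnW t_ge2) qE
    (etrans prod (congr1 -%R degree_succE)) (etrans (congr1 (fun z => s * (z - mu)) (esym degree_succE)) lE)
    (etrans (congr1 (fun z => s * (z - mu')) (esym degree_succE)) l'E).
  by apply/eqP; apply: (odd_root_ratio_eigen0 xu eig sum prod oc od).
exact: (aligned_edges_absurd n12 n ends kneg eig0).
Qed.

(** Eigenvectors at - r are killed by B^T, so the common sign holds on the whole spectrum and the
    end differences agree up to that sign. Exchanging [e3] and [e4] removes a negative sign. *)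
Lemma no_transfer_edge_edge (s : R) (e1 e2 e3 e4 : E) :
  e1 != e2 -> [set e1; e2] != [set e3; e4] ->
  transfers Qadj s (fun w => w (inr e1) - w (inr e2)) (fun w => w (inr e3) - w (inr e4)) ->
  False.
Proof.
move=> n12 nset tr.
pose y (e f : E) (u : V) : R := (u \in val e)%:R - (u \in val f)%:R.
have sumy e f x : \sum_u x u * y e f u = Bt x e - Bt x f.
  rewrite -!sum_edge_ind -sumrB; apply: eq_bigr => u _; by rewrite /y mulrBr.
have [eps epsE] : exists eps : bool, forall x k, Aeig x k -> k != - r%:R ->
    \sum_u x u * y e3 e4 u = (-1) ^+ eps * \sum_u x u * y e1 e2 u.
  apply: (transfer_same_sign (c := id) tr) => [x mu|x mu|//].
  - by rewrite sumy /= mulrBr.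
  - by rewrite sumy /= mulrBr.
have yE u : y e3 e4 u - (-1) ^+ eps * y e1 e2 u = 0.
  apply: (@adj_eigen_separate R V adj adjS (fun u => y e3 e4 u - (-1) ^+ eps * y e1 e2 u)) => x k eig.
  have -> : \sum_u x u * (y e3 e4 u - (-1) ^+ eps * y e1 e2 u)
      = \sum_u x u * y e3 e4 u - (-1) ^+ eps * \sum_u x u * y e1 e2 u.
    by rewrite mulr_sumr -sumrB; apply: eq_bigr => v _; ring.
  have [kE|kn] := eqVneq k (- r%:R); last by rewrite (epsE x k) // subrr.
  by rewrite kE in eig; rewrite !sumy !(edge_ends_eigen_min adjS adj_reg eig) subrr mulr0 subrr.
case: eps {epsE} yE => yE.
  apply: (@no_transfer_edge_edge_aligned s e1 e2 e4 e3) => //.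
  - rewrite -negb_and; apply: contra nset => /andP[/eqP -> /eqP ->]; by rewrite finset.setUC.
  - by apply: transfers_oppr tr => w; rewrite opprB.
  - by move=> u; have := yE u; rewrite /y => /subr0_eq h; rewrite -opprB h mulN1r opprK.
apply: (@no_transfer_edge_edge_aligned s e1 e2 e3 e4) => //.
- by rewrite -negb_and; apply: contra nset => /andP[/eqP -> /eqP ->].
- by move=> u; have := yE u; rewrite /y mul1r => /subr0_eq.
Qed.

(** If mu is rational, so is k = N / mu - mu; then k is an integer, and so is mu, which divides N =
    2^t. An odd such divisor is 1 or -1, giving k = r or k = - r. *)
Lemma rational_root_int (x : V -> R) (k mu mu' : R) (u0 : V) (q : rat) :
  x u0 != 0 -> Aeig x k -> mu + mu' = - k -> mu * mu' = - N -> mu = ratr q ->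
  exists z : int, mu = z%:~R /\ (oddz z -> k = r%:R \/ k = - r%:R).
Proof.
move=> xn0 eig sum prod muq.
have Nn0 : N != 0 by rewrite pnatr_eq0.
have mun0 : mu != 0 by apply: contra_eq_neq prod => ->; rewrite mul0r eq_sym oppr_eq0.
have qn0 : q != 0 by apply: contraNneq mun0 => q0; rewrite muq q0 rmorph0.
have muE := vieta_root_left sum prod.
have kq : k = ratr (r.+1%:R / q - q).
  rewrite rmorphB fmorph_div /= ratr_nat -muq; apply: (mulIf mun0).
  by rewrite mulrBl divfK //; move: muE; rewrite expr2; lra.
have [c cE] : exists c : int, r.+1%:R / q - q = c%:~R.
  apply: (@int_eigenvalue_rat_int R V (fun u v => (adj u v)%:Z) x _ u0 xn0) => u.
  by rewrite -adj_sumE eig kq.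
have kc : k = c%:~R by rewrite kq cE ratr_int.
have [z zE] : exists z : int, q = z%:~R.
  apply: (@rat_quadratic_int c r.+1%:Z).
  by rewrite -cE mulrBl divfK // -expr2 -[r.+1%:Z%:~R]/(r.+1%:R); ring.
have muz : mu = z%:~R by rewrite muq zE ratr_int.
exists z; split=> // oz.
have zz : z * (z + c) = 2 ^+ t.
  apply: (@intr_inj R); rewrite rmorphXn /= -degree_succE -muE intrM intrD -muz -kc; ring.
have : (z %| 2 ^+ t)%Z by rewrite -zz dvdz_mulr.
rewrite -[2 ^+ t]mulr1 Gauss_dvdzr; last first.
  by rewrite coprimezXr // coprimezE /= coprimen2.
rewrite dvdz1 => /eqP z1.
have [z1'|z1'] : z = 1 \/ z = -1 by move: z1; clear; lia.
  by left; move: muE; rewrite muz z1' -natr1 expr1n mulr1 addrC => /addIr.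
by right; move: muE; rewrite muz z1' -natr1 sqrrN expr1n mulrN1 addrC => /addIr <-; rewrite opprK.
Qed.

(** This is the lift of the constant vector, with k = r and mu = 1. It tells old vertices from new
    ones and serves as the reference phase for mixed pairs. *)
Lemma Q_eigen_two_valued :
  laplacian_eigen Qadj (@Qfun R V adj (fun=> - r%:R) (fun=> 2)) (1 + N).
Proof.
have eig1 (u : V) : Ad (fun=> 1) u = r%:R * 1.
  by rewrite /adj_sum sumr_const -(adj_reg u) cardsE mulr1.
have lam1 : (1 : R) ^+ 2 + r%:R * 1 = N by rewrite expr1n mulr1 addrC natr1.
have := Q_eigen_lift adjS adj_reg eig1 lam1; congr (laplacian_eigen _ _ _).
apply/funext => -[u|f] /=; first by rewrite -natr1; ring.
by rewrite [Bt _ f](edge_ends_const adjS) mul1r mulr1.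
Qed.

(** The references mu = 1 and mu = N make s r an integer, of parity b0, so all mu in the support are
    integers if s is nonzero. As r is odd, s (mu - 1) has parity b0 whenever mu is even or b0 is 0.
    Parity 0 makes the states equal; parity 1 makes a kernel vector built on e and e' vanish,
    leaving too few edges at a vertex. *)
Lemma no_transfer_mixed (s : R) (v v' : V) (e e' : E) : connected_graph adj ->
  (v != v') || (e != e') ->
  transfers Qadj s (fun w => w (inl v) - w (inr e)) (fun w => w (inl v') - w (inr e')) ->
  False.
Proof.
move=> conn ne [T1 T2].
have Nn0 : N != 0 by rewrite pnatr_eq0.
have rn0 : r%:R != 0 :> R by rewrite pnatr_eq0; have := degree_gt2; case: (r).
have P1 : - r%:R - 2 != 0 :> R by rewrite -opprD oppr_eq0 -natrD pnatr_eq0 addn2.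
have phase w mu : laplacian_eigen Qadj w (mu + N) -> w (inl v) - w (inr e) != 0 ->
    exists (k : int) (b : bool), s * (mu - 1) = (2 * k + b%:Z)%:~R /\
      w (inl v') - w (inr e') = (-1) ^+ b * (w (inl v) - w (inr e)).
  move=> ew Pw; have [k [b [sE qE]]] := T2 _ _ _ _ ew Q_eigen_two_valued Pw P1; exists k, b; split.
    by rewrite -sE; congr (_ * _); ring.
  by apply: (mulIf P1); rewrite -mulrA; exact: qE.
have [h [Bh he]] := exists_kernel_edge R adjS adj_reg e degree_gt2.
have [K [b0 [sr _]]] : exists (k : int) (b : bool), s * (N - 1) = (2 * k + b%:Z)%:~R /\
      Qfun (fun=> 0) h (inl v') - Qfun (fun=> 0) h (inr e')
       = (-1) ^+ b * (Qfun (fun=> 0) h (inl v) - Qfun (fun=> 0) h (inr e)).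
  by apply: phase (Q_eigen_kernel adjS adj_reg Bh) _; rewrite /= sub0r oppr_eq0.
have srE : s * r%:R = (2 * K + b0%:Z)%:~R by rewrite -sr -natr1 addrK.
have sq : exists q : rat, s = ratr q.
  exists ((2 * K + b0%:Z)%:~R / r%:R); rewrite fmorph_div /= ratr_int ratr_nat -srE.
  by rewrite mulfK.
have oddr : oddz r%:Z by rewrite /oddz /= degree_odd.
have parity (k : int) (b : bool) (z : int) : s * (z%:~R - 1) = (2 * k + b%:Z)%:~R ->
    ~~ oddz z || ~~ b0 -> b = b0.
  move=> sz; have zE : r%:Z * (2 * k + b%:Z) = (2 * K + b0%:Z) * (z - 1).
    by apply: (@intr_inj R); rewrite intrM -sz intrM -srE intrB; ring.
  have : oddz (r%:Z * (2 * k + b%:Z)) = oddz ((2 * K + b0%:Z) * (z - 1)) by rewrite zE.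
  rewrite !oddzM oddr /= ![2 * _ + _]addrC !oddzD2.
  have -> : oddz (z - 1) = ~~ oddz z by rewrite /oddz; clear; lia.
  by case: b {sz zE}; case: b0 {sr srE}; case: (oddz z).
have sign x k mu : Aeig x k -> mu ^+ 2 + k * mu = N -> ~~ b0 || ((k != r%:R) && (k != - r%:R)) ->
    (mu - N) * x v' - mu * Bt x e' = (-1) ^+ b0 * ((mu - N) * x v - mu * Bt x e).
  move=> eig muE hyp; have ew := Q_eigen_lift adjS adj_reg eig muE.
  have [P0|Pn0] := eqVneq ((mu - N) * x v - mu * Bt x e) 0.
    have /eqP := T1 _ _ ew; rewrite /= P0 expr0n sqrf_eq0 => /eqP ->.
    by rewrite mulr0.
  have [k' [b [sE qE]]] := phase _ _ ew Pn0; move: qE; rewrite /= => ->; suff -> : b = b0 by [].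
  have [s0|sn0] := eqVneq s 0.
    have e0 : (2 * K + b0%:Z)%:~R = 0 :> R by rewrite -srE s0 mul0r.
    have e1 : (2 * k' + b%:Z)%:~R = 0 :> R by rewrite -sE s0 mul0r.
    move/eqP: e0; move/eqP: e1; rewrite !intr_eq0 => /eqP e1 /eqP e0.
    have := congr1 oddz e0; have := congr1 oddz e1; rewrite ![2 * _ + _]addrC !oddzD2.
    by case: (b); case: (b0).
  (* Both s and s (mu - 1) are rational and s is nonzero, so mu is rational. *)
  have [q qs] := sq.
  have qn0 : q != 0 by apply: contraNneq sn0 => q0; rewrite qs q0 rmorph0.
  have muq : mu = ratr ((2 * k' + b%:Z)%:~R / q + 1).
    rewrite rmorphD fmorph_div rmorph1 /= ratr_int -sE -qs mulrC mulKf //.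
    by rewrite subrK.
  have mun0 : mu != 0.
    by apply/eqP => mu0; move/esym/eqP: muE; rewrite mu0 expr0n mulr0 addr0 (negbTE Nn0).
  have prod : mu * (- k - mu) = - N by rewrite -muE; ring.
  have sum : mu + (- k - mu) = - k by ring.
  have [u0 xu0] : exists u0, x u0 != 0.
    apply/existsP; apply: contraNT Pn0; rewrite negb_exists => /forallP x0.
    have x00 u : x u = 0 by apply/eqP; move: (x0 u); rewrite negbK.
    by rewrite x00 [Bt x e]big1 ?mulr0 ?subrr.
  have [z [zE zodd]] := rational_root_int xu0 eig sum prod muq.
  apply: (parity k' b z); first by rewrite -zE.
  case/orP: hyp => [->|/andP[kr kr']]; first by rewrite orbT.
  apply/orP; left; apply/negP => /zodd[] kE; first by rewrite kE eqxx in kr.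
  by rewrite kE eqxx in kr'.
(* The sign relations at the two roots form a linear system for the vertex and edge components;
   eliminating the edge part leaves the factor N (mu - mu'). *)
have split_sign x k : Aeig x k -> k != - r%:R -> ~~ b0 || (k != r%:R) ->
    x v' = (-1) ^+ b0 * x v /\ Bt x e' = (-1) ^+ b0 * Bt x e.
  move=> eig kn hyp; have [mu [mu' [mu_gt0 mu'_lt0 sum prod]]] := lift_roots k.
  have hyp' : ~~ b0 || ((k != r%:R) && (k != - r%:R)) by rewrite kn andbT.
  have h1 := sign _ _ _ eig (vieta_root_left sum prod) hyp'.
  have h2 := sign _ _ _ eig (vieta_root_right sum prod) hyp'.
  have dn0 : mu - mu' != 0 by rewrite subr_eq0 gt_eqF // (lt_trans mu'_lt0).
  move: h1 h2; move: ((-1) ^+ b0) => eps h1 h2.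
  have A0 : x v' - eps * x v = 0.
    apply: (mulfI dn0); apply: (mulfI Nn0).
    transitivity (mu' * (((mu - N) * x v' - mu * Bt x e') - eps * ((mu - N) * x v - mu * Bt x e))
      - mu * (((mu' - N) * x v' - mu' * Bt x e') - eps * ((mu' - N) * x v - mu' * Bt x e))).
      by ring.
    by rewrite h1 h2 !subrr !mulr0 subrr.
  have xE : x v' = eps * x v by move/subr0_eq: A0.
  split=> //; have mun0 : mu != 0 by rewrite gt_eqF.
  apply: (mulfI mun0); rewrite xE in h1; move: h1; lra.
have ends_sign x k : Aeig x k -> ~~ b0 || (k != r%:R) -> Bt x e' = (-1) ^+ b0 * Bt x e.
  move=> eig hyp; have [kE|kn] := eqVneq k (- r%:R); last by have [] := split_sign _ _ eig kn hyp.
  by rewrite kE in eig; rewrite !(edge_ends_eigen_min adjS adj_reg eig) mulr0.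
have [b0E|b0E] := boolP b0; last first.
  have vv : v = v'.
    have : indic R v v - indic R v' v = 0.
      apply: (@adj_eigen_separate R V adj adjS (fun u => indic R v u - indic R v' u)) => x k eig.
      rewrite sum_indicB; apply/eqP; rewrite subr_eq0 eq_sym; apply/eqP.
      have [kE|kn] := eqVneq k (- r%:R); last first.
        have [] := split_sign _ _ eig kn; first by rewrite b0E.
        by rewrite (negbTE b0E) mul1r.
      (* Over k = - r the root N would annihilate the lift; the root -1 keeps the vertex component,
         with nonzero factor -1 - N. *)
      have muE : (-1) ^+ 2 + k * -1 = N by rewrite kE sqrrN expr1n mulrN1 opprK addrC natr1.
      have := sign _ _ _ eig muE; rewrite b0E => /(_ isT); rewrite kE in eig.
      rewrite !(edge_ends_eigen_min adjS adj_reg eig) !mulr0 !subr0 (negbTE b0E) mul1r.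
      have n0 : -1 - N != 0 by rewrite -opprD oppr_eq0 addrC natr1 pnatr_eq0.
      by move/(mulfI n0).
    by rewrite indic_refl; have [->|[_ //]] := indic_cases R v' v; rewrite subr0 => /eqP; rewrite oner_eq0.
  have ee : e = e'.
    apply: val_inj; apply/setP => u.
    have h0 : (u \in val e)%:R - (u \in val e')%:R = 0 :> R.
      apply: (@adj_eigen_separate R V adj adjS (fun u => (u \in val e)%:R - (u \in val e')%:R)) => x k eig.
      under eq_bigr do rewrite mulrBr; rewrite sumrB !sum_edge_ind (ends_sign x k) ?b0E //.
      by rewrite (negbTE b0E) mul1r subrr.
    move/subr0_eq/eqP: h0; rewrite eqr_nat; by case: (_ \in _); case: (_ \in _).
  by move: ne; rewrite vv ee !eqxx.
(* In the odd case the components at [e] and [e'] cancel for every k other than r, so [y] is an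
   eigenvector at r and constant by connectedness. *)
pose y (u : V) : R := (u \in val e)%:R + (u \in val e')%:R.
have eigy : Aeig y r%:R.
  apply: (adj_eigen_of_orth adjS) => x k eig kn; rewrite /y.
  under eq_bigr do rewrite mulrDr; rewrite big_split /= !sum_edge_ind (ends_sign x k) ?kn ?orbT //.
  by rewrite b0E mulN1r subrr.
have yconst := adj_eigen_harmonic_const adjS adj_reg conn eigy.
(* A kernel vector has mu = N, so its phase relative to mu = 1 is s r, which is odd here. *)
have kneg g : (forall u, B g u = 0) -> g e + g e' = 0.
  move=> Bg; have eg := Q_eigen_kernel adjS adj_reg Bg.
  have [g0|gn0] := eqVneq (g e) 0.
    have /eqP := T1 _ _ eg; rewrite /= g0 !sub0r !sqrrN expr0n sqrf_eq0 => /eqP ->.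
    by rewrite addr0.
  have [] := phase _ _ eg; first by rewrite /= sub0r oppr_eq0.
  move=> k [b [sE]]; rewrite /= !sub0r.
  have -> : b = true.
    have : (2 * k + b%:Z) = (2 * K + b0%:Z) by apply: (@intr_inj R); rewrite -sE.
    move/(congr1 oddz); rewrite ![2 * _ + _]addrC !oddzD2 b0E; by case: (b).
  by rewrite mulN1r opprK => <-; rewrite addNr.
(* Chosen so that B maps the constant c to the constant value of [y]; then [g] is in the kernel and
   has norm zero by [kneg]. *)
pose c : R := y v / r%:R.
pose g (f : E) : R := (indic R e f + indic R e' f) - c.
have Bg u : B g u = 0.
  transitivity ((B (indic R e) u + B (indic R e') u) - B (fun=> c) u).
    by rewrite /edge_star -big_split -sumrB.
  rewrite !edge_star_delta (edge_star_const adjS adj_reg) /c mulrC divfK //.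
  by rewrite -/(y u) (yconst u v) subrr.
have sumg : \sum_f g f = 0.
  have := @sum_edge_star R V adj (fun=> 1) g; rewrite big1 => [|u _]; last by rewrite Bg mulr0.
  under eq_bigr do rewrite [Bt (fun=> 1) _](edge_ends_const adjS) mulr1.
  by rewrite -mulr_sumr => /esym/eqP; rewrite mulf_eq0 pnatr_eq0 => /eqP.
have g0 : \sum_f g f ^+ 2 = 0.
  transitivity (\sum_f (g f * indic R e f + g f * indic R e' f - c * g f)).
    by apply: eq_bigr => f _; rewrite -mulrDr [c * _]mulrC -mulrBr.
  by rewrite sumrB big_split /= -mulr_sumr sumg !sum_indic (kneg g Bg) mulr0 subr0.
have gz f : g f = 0 by apply: (sum_sqr_eq0 g0).
have c_ge1 : c != 0.
  have : c = 1 + indic R e' e by move: (gz e); rewrite /g indic_refl => /subr0_eq.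
  by move=> ->; rewrite gt_eqF // ltr_wpDr ?indic_ge0.
(* Any other edge would carry the value - c, which is nonzero; so at most two edges meet [v],
   against r > 2. *)
have sub : [set f : E | v \in val f] \subset [set e; e'].
  apply/fintype.subsetP => f _; rewrite !inE; apply: contraT; rewrite negb_or => /andP[fe fe'].
  by move: (gz f); rewrite /g !indic_neq // addr0 sub0r => /eqP; rewrite oppr_eq0 (negbTE c_ge1).
have := leq_trans (subset_leq_card sub) _ => /(_ 2%N).
rewrite (card_edge_star adjS adj_reg) => h2; have := degree_gt2.
by rewrite ltnNge h2 // cards2; case: (_ != _).
Qed.

End QgraphTransfer.

(** * Case analysis on the kinds of the four vertices *)

Theorem theorem3p4 (R : realType) (V : finType) (adj : rel V) (r t : nat) :
  simple_graph adj -> connected_graph adj -> regular_graph adj r ->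
  (2 <= t)%N -> r.+1 = (2 ^ t)%N ->
  forall a b c d : Qgraph_vertex adj,
    ~ laplacian_PPST R (@Qgraph_adj V adj) a b c d.
Proof.
move=> adjS conn adj_reg t_ge2 rE a b c d [nab ncd nset [tau [chi [chi1 tr]]]].
have QS : simple_graph (@Qgraph_adj V adj).
  split=> [[u|e] [v|f]|[u|e]] //=; last by rewrite eqxx.
  by rewrite eq_sym disjoint_sym.
have T : transfers (@Qgraph_adj V adj) (tau / pi)
    (fun w : Qgraph_vertex adj -> R => w a - w b) (fun w => w c - w d).
  split=> [w l ew|w1 w2 l1 l2 e1 e2 p1 p2].
    exact: (transfer_sqr QS chi1 tr ew).
  exact: (transfer_sign QS chi1 tr e1 e2 p1 p2).
have two := T.1 _ _ (Q_eigen_two_valued R adjS adj_reg).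
have two_absurd : (- r%:R - 2) ^+ 2 = 0 :> R -> False.
  by move/eqP; rewrite sqrf_eq0 -opprD oppr_eq0 -natrD pnatr_eq0 addn2.
have two_absurd' : (2 - - r%:R) ^+ 2 = 0 :> R -> False.
  by rewrite -sqrrN opprB.
have sq := T.1.
clear tr chi1; move: T two sq nab ncd nset.
(* The two-valued eigenvector pairs to 0 with a state of one kind and not with a mixed one, which
   settles the eight cases with exactly one mixed state. *)
case: a => [a|a]; case: b => [b|b]; case: c => [c|c]; case: d => [d|d] T two sq nab ncd nset.
- apply: (no_transfer_vertex_vertex adjS adj_reg t_ge2 rE _ _ _ T) => //.
  apply: contra nset => /eqP/setP h; apply/eqP/setP => -[u|e]; rewrite !inE //.
  by have := h u; rewrite !inE.
- by apply: two_absurd; rewrite two /= subrr expr0n.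
- by apply: two_absurd'; rewrite two /= subrr expr0n.
- apply: (@no_transfer_vertex_edge_pair R V adj r adjS adj_reg a b c d nab) => w l ew.
  by rewrite -(sq _ _ ew).
- by apply: two_absurd; rewrite -two /= subrr expr0n.
- apply: (no_transfer_mixed adjS adj_reg t_ge2 rE conn _ T).
  by rewrite -negb_and; apply: contra nset => /andP[/eqP -> /eqP ->].
- have T' : transfers (@Qgraph_adj V adj) (tau / pi)
      (fun w : Qgraph_vertex adj -> R => w (inl a) - w (inr b)) (fun w => w (inl d) - w (inr c)).
    by apply: transfers_oppr T => w; rewrite opprB.
  apply: (no_transfer_mixed adjS adj_reg t_ge2 rE conn _ T').
  by rewrite -negb_and; apply: contra nset => /andP[/eqP -> /eqP ->]; rewrite finset.setUC.
- by apply: two_absurd; rewrite -two /= subrr expr0n.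
- by apply: two_absurd'; rewrite -two /= subrr expr0n.
- have T' : transfers (@Qgraph_adj V adj) (tau / pi)
      (fun w : Qgraph_vertex adj -> R => w (inl b) - w (inr a)) (fun w => w (inl c) - w (inr d)).
    by apply: transfers_oppl T => w; rewrite opprB.
  apply: (no_transfer_mixed adjS adj_reg t_ge2 rE conn _ T').
  by rewrite -negb_and; apply: contra nset => /andP[/eqP -> /eqP ->]; rewrite finset.setUC.
- have T' : transfers (@Qgraph_adj V adj) (tau / pi)
      (fun w : Qgraph_vertex adj -> R => w (inl b) - w (inr a)) (fun w => w (inl d) - w (inr c)).
    by apply: transfers_oppl (transfers_oppr _ T) => w; rewrite opprB.
  apply: (no_transfer_mixed adjS adj_reg t_ge2 rE conn _ T').
  by rewrite -negb_and; apply: contra nset => /andP[/eqP -> /eqP ->].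
- by apply: two_absurd'; rewrite -two /= subrr expr0n.
- apply: (@no_transfer_vertex_edge_pair R V adj r adjS adj_reg c d a b ncd) => w l ew.
  by rewrite (sq _ _ ew).
- by apply: two_absurd; rewrite two /= subrr expr0n.
- by apply: two_absurd'; rewrite two /= subrr expr0n.
- apply: (no_transfer_edge_edge adjS adj_reg t_ge2 rE _ _ T) => //.
  apply: contra nset => /eqP/setP h; apply/eqP/setP => -[u|e]; rewrite !inE //.
  by have := h e; rewrite !inE.
Qed.
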